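(* One has $$S_{\mathrm{BBG}} = \log 6 + \sum_{k=1}^{\infty} 2\,\mathrm{Re}\left[G_k\!\left(\tfrac{2}{3}e^{ik}\right)\right],$$ where the series over $k$ on the right-hand side converges absolutely.
   Context: $S_{\mathrm{BBG}} := \sum_{n=1}^{\infty}\frac1n\left(\frac{2+\sin n}{3}\right)^{n}$ (sine of the integer $n$ in radians). For integers $n\ge 1$, $k\ge 1$, $$c_k(n) := \frac{1}{2\pi}\int_0^{2\pi}\left(1+\frac{\sin\theta}{2}\right)^{n}e^{-ik\theta}\,d\theta.$$ For $k\ge1$ and $z\in\mathbb{C}$ with $|z|<1$, $G_k(z) := \sum_{n=1}^{\infty}\frac{c_k(n)}{n}z^n$. (The points $\tfrac23 e^{ik}$ have modulus $2/3<1$.) *)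

(* Defs.v *)
From Stdlib Require Import Reals.
From Coquelicot Require Import Coquelicot.
Open Scope R_scope.

(* All series of the source start at index 1, whereas Coquelicot's start at 0:
   below, the [m]-th term of a series is the term of index [n = S m]. *)

Definition S_BBG_term (m : nat) : R :=
  let n := S m in / INR n * ((2 + sin (INR n)) / 3) ^ n.

Definition S_BBG : R := Series S_BBG_term.

(* e^(it) *)
Definition expi (t : R) : C := (cos t, sin t).

Definition c (k n : nat) : C :=
  (RtoC (/ (2 * PI)) *
   RInt (V := C_R_CompleteNormedModule)
     (fun theta : R =>
        RtoC ((1 + sin theta / 2) ^ n) * expi (- (INR k * theta)))
     0 (2 * PI))%C.

Definition G_term (k : nat) (z : C) (m : nat) : C :=
  let n := S m in (c k n / RtoC (INR n) * Cpow z n)%C.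

(* Coquelicot's [Series] is for real terms only; this is the complex analogue.
   As with [RInt], the value is meaningful only when the series converges. *)
Definition CSeries (a : nat -> C) : C :=
  iota (T := C_CompleteNormedModule)
    (is_series (K := C_AbsRing) (V := C_NormedModule) a).

Definition G (k : nat) (z : C) : C := CSeries (G_term k z).

Definition G_point (k : nat) : C := (RtoC (2 / 3) * expi (INR k))%C.

Definition rhs_term (j : nat) : R :=
  let k := S j in 2 * Re (G k (G_point k)).

(* Main.v *)
Require Import Defs.
From Stdlib Require Import Reals.
From Coquelicot Require Import Coquelicot.
From Stdlib Require Import Lra Lia Psatz ZArith.
Open Scope R_scope.

(** Put b_n(k) for the probability that a walk on the integers, which stays put
    with probability 2/3 and moves one step left or right with probability 1/6
    each, goes from 0 to k in n steps.  Its characteristic function is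
    (2 + cos x)/3, so

      ((2 + sin n)/3)^n = b_n(0) + 2 sum_{k>=1} b_n(k) cos(k(n - pi/2)),

    while c_k(n) (2/3)^n = (-i)^k b_n(k).  Hence the term of index k of the series
    to be summed is 2 sum_n b_n(k) cos(k(n - pi/2))/n, and the theorem says that
    sum_n and sum_k may be exchanged, and that sum_n b_n(0)/n = log 6.

    The exchange is easy with an extra factor r^n, 0 < r < 1
    ([walk_exchange]); to let r tend to 1 one needs a summable majorant in k that
    is uniform in r.  By the ballot identity, (k/n) b_n(k) is the probability that
    the walk first reaches k at time n ([walk_ballot], [first_passage_S_S]).
    Consequently sum_n (k/n) b_n(k) z^n = u^k, where u is the root of modulus less
    than 1 of u + 1/u = 6/z - 4 ([passage_gen_eq]).  The map u -> u + 1/u sends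
    circles about 0 to ellipses with foci 2 and -2, which for z = r e^{ik} turns
    into |u| <= exp(-sqrt|sin(k/2)|/4); so the k-th sum is at most
    h_k = exp(-k sqrt|sin(k/2)|/4)/k for all r < 1 ([bbg_walk_bound]).  With h
    summable, dominated convergence gives absolute convergence over k, and also
    the convergence of the series on the left-hand side, whose terms are positive
    and whose Abel means are now bounded.  Evaluating the same exchange with n - pi/2
    replaced by 0 gives sum_n r^n b_n(0)/n = log(6u/r), which tends to log 6.

    Summability of h is where pi enters ([ex_series_passage_bound]).  Between 2^j and
    2^(j+1) the term h_k is harmless unless |sin(k/2)| is below about j^2/4^j, and
    the difference m of two such exceptional k has |sin(m/2)| that small as well.
    An irrationality measure |sin(m/2)| >= exp(-C m^(2/3)) then makes exceptional k
    at least c j^(3/2) apart, so that they contribute a convergent sum of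
    j^(-3/2) ([near_period_gap]).  Niven's integrals are just too weak for this:
    they only yield exponents of order m log m.

    The measure ([sin_half_nat_lower_bound]) comes from Hermite-Pade forms
    A + B cos r + C sin r with A, B, C integer polynomials of degree n up to a common
    factor 2^n n!, and with value of the order of r^(3n)/(3n)!: they are inverse Laplace
    transforms of z^(1-a) (z^2 + 1)^(-1-b).  At r = m/p near 2 pi, where cos r and sin r
    are replaced by 1 and 0, the form becomes a rational number A + B of
    denominator (2p)^n n!.  Taking n of order sqrt p makes the form at most half of
    the reciprocal of that denominator.  The replacement costs
    at most exp(C sqrt m log m) |r - 2 pi|.  If A + B vanishes, the cost is the form
    itself, which is bounded below; if not, it is at least half of the reciprocal of the
    denominator.  Both cases give |r - 2 pi| >= exp(-C sqrt m log m). *)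

(** * Power series behind the rational approximations to 2 pi *)

Lemma INR_fact_S n : INR (fact (S n)) = INR (S n) * INR (fact n).
Proof. now rewrite fact_simpl, mult_INR. Qed.

(** The binomial coefficient of b + j over j, as a real number. *)
Definition hp_coef (b j : nat) : R :=
  INR (fact (b + j)) / (INR (fact b) * INR (fact j)).

(** The power series sum_j of [hp_term a b r j] is the inverse Laplace transform
    of z^(1-a) (z^2 + 1)^(-1-b); the recurrences below are identities between such rational
    functions, or between their derivatives. *)
Definition hp_term (a b : nat) (r : R) (j : nat) : R :=
  (-1) ^ j * hp_coef b j *
  (r ^ (a + 2 * b + 2 * j) / INR (fact (a + 2 * b + 2 * j))).

Lemma hp_coef_0_r b : hp_coef b 0 = 1.
Proof.
  unfold hp_coef. rewrite Nat.add_0_r. simpl (fact 0). simpl (INR 1).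
  pose proof (INR_fact_neq_0 b). now field.
Qed.

Lemma hp_coef_0_l j : hp_coef 0 j = 1.
Proof.
  unfold hp_coef. simpl (fact 0). simpl (INR 1). simpl (0 + j)%nat.
  pose proof (INR_fact_neq_0 j). now field.
Qed.

Lemma hp_coef_pos b j : 0 < hp_coef b j.
Proof.
  unfold hp_coef. pose proof (INR_fact_lt_0 b). pose proof (INR_fact_lt_0 j).
  pose proof (INR_fact_lt_0 (b + j)).
  apply Rdiv_lt_0_compat; [easy|now apply Rmult_lt_0_compat].
Qed.

Lemma hp_coef_S_l b j :
  INR (S b) * hp_coef (S b) j = INR (S (b + j)) * hp_coef b j.
Proof.
  unfold hp_coef. replace (S b + j)%nat with (S (b + j)) by lia.
  rewrite !INR_fact_S.
  pose proof (INR_fact_neq_0 b). pose proof (INR_fact_neq_0 j).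
  assert (INR (S b) <> 0) by (apply not_0_INR; lia).
  field; auto.
Qed.

Lemma hp_coef_S_r b j :
  INR (S j) * hp_coef b (S j) = INR (S b) * hp_coef (S b) j.
Proof.
  unfold hp_coef. replace (b + S j)%nat with (S (b + j)) by lia.
  replace (S b + j)%nat with (S (b + j)) by lia.
  rewrite !INR_fact_S.
  pose proof (INR_fact_neq_0 b). pose proof (INR_fact_neq_0 j).
  assert (INR (S b) <> 0) by (apply not_0_INR; lia).
  assert (INR (S j) <> 0) by (apply not_0_INR; lia).
  field; auto.
Qed.

Lemma hp_coef_pascal b j :
  hp_coef (S b) (S j) = hp_coef b (S j) + hp_coef (S b) j.
Proof.
  pose proof (hp_coef_S_r b j) as H1. pose proof (hp_coef_S_r (S b) j) as H2.
  pose proof (hp_coef_S_l b (S j)) as H3.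
  assert (0 < INR (S b)) by (apply lt_0_INR; lia).
  apply Rmult_eq_reg_l with (INR (S b)); [|lra].
  replace (INR (S (b + S j))) with (INR (S j) + INR (S b)) in H3
    by (rewrite <- plus_INR; f_equal; lia).
  lra.
Qed.

Lemma is_series_Rscal (c : R) (a : nat -> R) (l : R) :
  is_series a l -> is_series (fun n => c * a n) (c * l).
Proof. exact (is_series_scal c a l). Qed.

Lemma is_series_Rplus (a b : nat -> R) (la lb : R) :
  is_series a la -> is_series b lb -> is_series (fun n => a n + b n) (la + lb).
Proof. exact (is_series_plus a b la lb). Qed.

Lemma is_series_Ropp (a : nat -> R) (l : R) :
  is_series a l -> is_series (fun n => - a n) (- l).
Proof. exact (is_series_opp a l). Qed.

Lemma is_series_Rminus (a b : nat -> R) (la lb : R) :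
  is_series a la -> is_series b lb -> is_series (fun n => a n - b n) (la - lb).
Proof. exact (is_series_minus a b la lb). Qed.

Lemma is_series_Rext (a b : nat -> R) (l : R) :
  (forall n, a n = b n) -> is_series a l -> is_series b l.
Proof. exact (is_series_ext a b l). Qed.

Lemma is_series_tail (a : nat -> R) (l : R) :
  is_series a l -> is_series (fun j => a (S j)) (l - a 0%nat).
Proof.
  intros H. apply is_series_incr_1.
  replace (plus _ _) with l by (unfold plus; simpl; ring). easy.
Qed.

(** Multiply 1 = (z^2 + 1) - z^2 by z^(-1-a) (z^2 + 1)^(-2-b). *)
Lemma hp_series_SS_S a b r x y :
  is_series (hp_term (S (S a)) b r) x -> is_series (hp_term a (S b) r) y ->
  is_series (hp_term (S (S a)) (S b) r) (x - y).
Proof.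
  intros Hx Hy.
  pose proof (is_series_tail _ _ (is_series_Rminus _ _ _ _ Hx Hy)) as H.
  replace (x - y) with (x - y - (hp_term (S (S a)) b r 0 - hp_term a (S b) r 0)).
  - revert H. apply is_series_Rext. intros j.
    unfold hp_term.
    replace (a + 2 * S b + 2 * S j)%nat with (S (S a) + 2 * b + 2 * S j)%nat by lia.
    replace (S (S a) + 2 * S b + 2 * j)%nat with (S (S a) + 2 * b + 2 * S j)%nat by lia.
    rewrite hp_coef_pascal. simpl ((-1) ^ S j). ring.
  - unfold hp_term. rewrite !hp_coef_0_r.
    replace (a + 2 * S b + 2 * 0)%nat with (S (S a) + 2 * b + 2 * 0)%nat by lia. ring.
Qed.

Lemma hp_series_SS_0 a r x :
  is_series (hp_term a 0 r) x ->
  is_series (hp_term (S (S a)) 0 r) (r ^ a / INR (fact a) - x).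
Proof.
  intros Hx. apply is_series_tail, is_series_Ropp in Hx.
  replace (r ^ a / INR (fact a) - x) with (- (x - hp_term a 0 r 0)).
  - revert Hx. apply is_series_Rext. intros j.
    unfold hp_term. rewrite !hp_coef_0_l.
    replace (a + 2 * 0 + 2 * S j)%nat with (S (S a) + 2 * 0 + 2 * j)%nat by lia.
    simpl ((-1) ^ S j). ring.
  - unfold hp_term. rewrite hp_coef_0_l.
    replace (a + 2 * 0 + 2 * 0)%nat with a by lia.
    simpl. field. apply INR_fact_neq_0.
Qed.

(** Differentiation in z corresponds to multiplication by -r; here it is applied
    to (z^2 + 1)^(-1-b). *)
Lemma hp_series_0_S b r x :
  is_series (hp_term 1 b r) x ->
  is_series (hp_term 0 (S b) r) (r * x / (2 * INR (S b))).
Proof.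
  intros Hx. apply (is_series_Rscal (r / (2 * INR (S b)))) in Hx.
  replace (r * x / (2 * INR (S b))) with (r / (2 * INR (S b)) * x).
  - revert Hx. apply is_series_Rext. intros j.
    unfold hp_term.
    replace (0 + 2 * S b + 2 * j)%nat with (S (1 + 2 * b + 2 * j)) by lia.
    pose proof (hp_coef_S_l b j) as Hc.
    rewrite INR_fact_S. set (q := (1 + 2 * b + 2 * j)%nat).
    pose proof (INR_fact_neq_0 q).
    assert (Hq : INR (S q) = 2 * INR (S (b + j))).
    { unfold q. replace 2 with (INR 2) by easy. rewrite <- mult_INR. f_equal. lia. }
    assert (INR (S b) <> 0) by (apply not_0_INR; lia).
    assert (INR (S (b + j)) <> 0) by (apply not_0_INR; lia).
    replace (hp_coef (S b) j) with (INR (S (b + j)) * hp_coef b j / INR (S b)).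
    + rewrite Hq. rewrite <- tech_pow_Rmult. field. auto.
    + rewrite <- Hc. now field.
  - assert (INR (S b) <> 0) by (apply not_0_INR; lia).
    now field.
Qed.

(** The same rule applied to z (z^2 + 1)^(-1-b), whose derivative is a combination
    of the powers -1-b and -2-b of z^2 + 1. *)
Lemma hp_series_1_S b r x y :
  is_series (hp_term 1 b r) x -> is_series (hp_term 0 b r) y ->
  is_series (hp_term 1 (S b) r)
    ((INR (2 * b + 1) * x - r * y) / (2 * INR (S b))).
Proof.
  intros Hx Hy.
  assert (Hb : INR (S b) <> 0) by (apply not_0_INR; lia).
  apply (is_series_Rscal (INR (2 * b + 1) / (2 * INR (S b)))) in Hx.
  apply (is_series_Rscal (r / (2 * INR (S b)))) in Hy.
  pose proof (is_series_tail _ _ (is_series_Rminus _ _ _ _ Hx Hy)) as H.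
  match type of H with is_series _ (?l - ?t) =>
    replace ((INR (2 * b + 1) * x - r * y) / (2 * INR (S b))) with (l - t) end.
  - revert H. apply is_series_Rext. intros j.
    unfold hp_term.
    replace (0 + 2 * b + 2 * S j)%nat with (2 * b + 2 * S j)%nat by lia.
    replace (1 + 2 * b + 2 * S j)%nat with (S (2 * b + 2 * S j)) by lia.
    replace (1 + 2 * S b + 2 * j)%nat with (S (2 * b + 2 * S j)) by lia.
    rewrite INR_fact_S. set (q := (2 * b + 2 * S j)%nat).
    pose proof (INR_fact_neq_0 q).
    pose proof (hp_coef_S_r b j) as Hc.
    assert (Hq : INR (S q) = INR (2 * b + 1) + 2 * INR (S j)).
    { unfold q. replace (2 * INR (S j)) with (INR (2 * S j)) by now rewrite mult_INR.
      rewrite <- plus_INR. f_equal. lia. }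
    assert (INR (S j) <> 0) by (apply not_0_INR; lia).
    assert (HSq : INR (S q) <> 0) by (apply not_0_INR; lia).
    replace (hp_coef (S b) j) with (INR (S j) * hp_coef b (S j) / INR (S b))
      by (rewrite Hc; now field).
    replace (INR (2 * b + 1)) with (INR (S q) - 2 * INR (S j)) by lra.
    rewrite <- !tech_pow_Rmult. field. auto.
  - unfold hp_term.
    rewrite !hp_coef_0_r.
    replace (0 + 2 * b + 2 * 0)%nat with (2 * b)%nat by lia.
    replace (1 + 2 * b + 2 * 0)%nat with (S (2 * b)) by lia.
    replace (2 * b + 1)%nat with (S (2 * b)) by lia.
    rewrite INR_fact_S. pose proof (INR_fact_neq_0 (2 * b)).
    assert (INR (S (2 * b)) <> 0) by (apply not_0_INR; lia).
    rewrite <- tech_pow_Rmult. field. auto.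
Qed.

Lemma hp_series_0_0 r : is_series (hp_term 0 0 r) (cos r).
Proof.
  unfold cos. destruct (exist_cos (Rsqr r)) as [l Hl]. simpl.
  apply is_series_Reals. unfold cos_in in Hl.
  unfold infinite_sum in *. intros eps He. destruct (Hl eps He) as [N HN].
  exists N. intros n Hn. specialize (HN n Hn).
  rewrite (sum_eq _ (fun i => cos_n i * Rsqr r ^ i)); [easy|].
  intros i _. unfold hp_term, cos_n. rewrite hp_coef_0_l.
  replace (0 + 2 * 0 + 2 * i)%nat with (2 * i)%nat by lia.
  rewrite pow_mult, <- Rsqr_pow2. field. apply INR_fact_neq_0.
Qed.

Lemma hp_series_1_0 r : is_series (hp_term 1 0 r) (sin r).
Proof.
  unfold sin. destruct (exist_sin (Rsqr r)) as [l Hl]. simpl.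
  assert (H : is_series (fun i => sin_n i * Rsqr r ^ i) l) by now apply is_series_Reals.
  apply (is_series_Rscal r) in H. revert H. apply is_series_Rext. intros i.
  
  unfold hp_term, sin_n. rewrite hp_coef_0_l.
  replace (1 + 2 * 0 + 2 * i)%nat with (S (2 * i)) by lia.
  replace (2 * i + 1)%nat with (S (2 * i)) by lia.
  rewrite <- tech_pow_Rmult.
  rewrite pow_mult, <- Rsqr_pow2. field. apply INR_fact_neq_0.
Qed.

(** * Size and arithmetic of the Hermite-Pade forms *)

Lemma is_series_Rabs_le (a b : nat -> R) (la lb : R) :
  (forall n, Rabs (a n) <= b n) -> is_series a la -> is_series b lb ->
  Rabs la <= lb.
Proof.
  intros Hab Ha Hb.
  rewrite <- (is_series_unique _ _ Ha), <- (is_series_unique _ _ Hb).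
  assert (Hex : ex_series (fun n => Rabs (a n))).
  { apply (ex_series_le (V := R_CompleteNormedModule)) with b; [|now exists lb].
    intros n. unfold norm; simpl; unfold abs; simpl. rewrite Rabs_Rabsolu. apply Hab. }
  eapply Rle_trans; [now apply Series_Rabs|].
  apply Series_le; [|now exists lb].
  intros n. split; [apply Rabs_pos|apply Hab].
Qed.

(** All that follows the first term is a geometric series of sum one third of it, so the
    first term yields lower bounds as well as upper bounds. *)
Lemma is_series_ratio_quarter (a : nat -> R) (l : R) :
  (forall j, Rabs (a (S j)) <= Rabs (a j) / 4) -> is_series a l ->
  Rabs (l - a 0%nat) <= Rabs (a 0%nat) / 3.
Proof.
  intros Ha Hl.
  assert (Hg : is_series (fun j => Rabs (a 0%nat) / 4 * (/ 4) ^ j) (Rabs (a 0%nat) / 3)).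
  { replace (Rabs (a 0%nat) / 3) with (Rabs (a 0%nat) / 4 * / (1 - / 4)) by lra.
    apply is_series_Rscal, is_series_geom. rewrite Rabs_pos_eq; lra. }
  apply (is_series_Rabs_le _ _ _ _) with (2 := is_series_tail _ _ Hl) (3 := Hg).
  induction n as [|n IH].
  - specialize (Ha 0%nat). simpl. lra.
  - specialize (Ha (S n)). rewrite <- tech_pow_Rmult. lra.
Qed.

Lemma hp_term_ratio n r j : (80 <= n)%nat -> 1 <= r <= 9 ->
  Rabs (hp_term n n r (S j)) <= Rabs (hp_term n n r j) / 4.
Proof.
  intros Hn Hr. unfold hp_term.
  replace (n + 2 * n + 2 * S j)%nat with (S (S (n + 2 * n + 2 * j))) by lia.
  set (N := (n + 2 * n + 2 * j)%nat).
  rewrite !Rabs_mult, !pow_1_abs, !Rmult_1_l.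
  pose proof (hp_coef_pos n j) as H1. pose proof (hp_coef_pos n (S j)) as H2.
  rewrite (Rabs_pos_eq (hp_coef n j)), (Rabs_pos_eq (hp_coef n (S j))) by lra.
  pose proof (INR_fact_lt_0 N) as HN.
  assert (Hp : 0 < r ^ N) by (apply pow_lt; lra).
  assert (HS1 : 0 < INR (S N)) by (apply lt_0_INR; lia).
  assert (HS2 : 0 < INR (S (S N))) by (apply lt_0_INR; lia).
  assert (HSj : 0 < INR (S j)) by (apply lt_0_INR; lia).
  rewrite !INR_fact_S, <- !tech_pow_Rmult.
  assert (Ht : 0 < r ^ N / INR (fact N)) by now apply Rdiv_lt_0_compat.
  rewrite (Rabs_pos_eq (r ^ N / INR (fact N))) by lra.
  replace (r * (r * r ^ N) / (INR (S (S N)) * (INR (S N) * INR (fact N))))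
    with (r ^ N / INR (fact N) * (r * r / (INR (S (S N)) * INR (S N)))) by (field; lra).
  rewrite Rabs_pos_eq.
  2: { apply Rmult_le_pos; [lra|]. apply Rdiv_le_0_compat; nra. }
  replace (hp_coef n (S j)) with (INR (S (n + j)) * hp_coef n j / INR (S j)).
  2: { rewrite <- hp_coef_S_l, <- hp_coef_S_r. field. lra. }
  replace (INR (S (n + j)) * hp_coef n j / INR (S j) *
    (r ^ N / INR (fact N) * (r * r / (INR (S (S N)) * INR (S N)))))
    with (hp_coef n j * (r ^ N / INR (fact N)) *
      (INR (S (n + j)) * (r * r) / (INR (S j) * INR (S (S N)) * INR (S N)))) by (field; lra).
  replace (hp_coef n j * (r ^ N / INR (fact N)) / 4)
    with (hp_coef n j * (r ^ N / INR (fact N)) * / 4) by lra.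
  apply Rmult_le_compat_l; [nra|].
  assert (HD : 0 < INR (S j) * INR (S (S N)) * INR (S N)).
  { apply Rmult_lt_0_compat; [now apply Rmult_lt_0_compat|easy]. }
  apply Rle_div_l; [easy|].
  assert (Hr2 : r * r <= 81) by nra.
  assert (Hk : INR (4 * 81 * S (n + j)) <= INR (S j * S (S N) * S N)).
  { apply le_INR. unfold N. nia. }
  rewrite !mult_INR in Hk. simpl (INR 4) in Hk. simpl (INR 81) in Hk.
  assert (0 < INR (S (n + j))) by (apply lt_0_INR; lia).
  nra.
Qed.

Lemma hp_size n r y : (80 <= n)%nat -> 1 <= r <= 9 ->
  is_series (hp_term n n r) y ->
  2 / 3 * (r ^ (3 * n) / INR (fact (3 * n))) <= y <=
  4 / 3 * (r ^ (3 * n) / INR (fact (3 * n))).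
Proof.
  intros Hn Hr Hy.
  pose proof (is_series_ratio_quarter _ _ (fun j => hp_term_ratio n r j Hn Hr) Hy) as H.
  assert (E : hp_term n n r 0 = r ^ (3 * n) / INR (fact (3 * n))).
  { unfold hp_term. rewrite hp_coef_0_r.
    replace (n + 2 * n + 2 * 0)%nat with (3 * n)%nat by lia. simpl pow at 1. ring. }
  rewrite E in H.
  assert (Ht : 0 < r ^ (3 * n) / INR (fact (3 * n))).
  { apply Rdiv_lt_0_compat; [apply pow_lt; lra|apply INR_fact_lt_0]. }
  rewrite (Rabs_pos_eq (_ / _)) in H by lra.
  apply Rabs_le_between in H. lra.
Qed.

(** A multiple D y of y is an integral combination of 1, cos r and sin r.  The
    coefficient of 1 is not bounded: it is to be absorbed in an integer. *)
Definition hp_rep (D r H y : R) : Prop :=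
  exists al be ga : Z,
    D * y = IZR al + IZR be * cos r + IZR ga * sin r /\
    Rabs (IZR be) <= H /\ Rabs (IZR ga) <= H.

Lemma hp_rep_lin (u v : Z) D D' r H1 H2 H x y z :
  hp_rep D r H1 x -> hp_rep D r H2 y ->
  D' * z = IZR u * (D * x) + IZR v * (D * y) ->
  Rabs (IZR u) * H1 + Rabs (IZR v) * H2 <= H ->
  hp_rep D' r H z.
Proof.
  intros (a1 & b1 & c1 & E1 & B1 & C1) (a2 & b2 & c2 & E2 & B2 & C2) E HH.
  exists (u * a1 + v * a2)%Z, (u * b1 + v * b2)%Z, (u * c1 + v * c2)%Z.
  rewrite !plus_IZR, !mult_IZR. split; [rewrite E, E1, E2; ring|].
  pose proof (Rabs_pos (IZR u)). pose proof (Rabs_pos (IZR v)).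
  split; (eapply Rle_trans; [apply Rabs_triang|]); rewrite !Rabs_mult; nra.
Qed.

Lemma hp_rep_int (k : Z) D r x : D * x = IZR k -> hp_rep D r 0 x.
Proof.
  intros E. exists k, 0%Z, 0%Z. rewrite E, Rabs_R0. split; [ring|lra].
Qed.

Lemma hp_rep_weaken D r H H' x : H <= H' -> hp_rep D r H x -> hp_rep D r H' x.
Proof. intros HH (a & b & c & E & B & C). exists a, b, c. repeat split; lra. Qed.

(** Common denominator of the forms of level at most b at a rational point of
    denominator p: p^b clears the powers of r, while 2^b b! clears the divisions in
    [hp_series_0_S] and [hp_series_1_S]. *)
Definition hp_den (p b : nat) : R := (2 * INR p) ^ b * INR (fact b).
Definition hp_height (p b : nat) : R := (12 * INR p) ^ b * INR (fact b).

Lemma hp_den_S p b : hp_den p (S b) = 2 * INR p * INR (S b) * hp_den p b.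
Proof. unfold hp_den. rewrite INR_fact_S, <- tech_pow_Rmult. ring. Qed.

Lemma hp_height_S p b : hp_height p (S b) = 12 * INR p * INR (S b) * hp_height p b.
Proof. unfold hp_height. rewrite INR_fact_S, <- tech_pow_Rmult. ring. Qed.

Lemma hp_height_pos p b : (1 <= p)%nat -> 0 < hp_height p b.
Proof.
  intros Hp. apply (le_INR 1) in Hp. simpl in Hp.
  apply Rmult_lt_0_compat; [apply pow_lt; lra|apply INR_fact_lt_0].
Qed.

Lemma INR_fact_div a n : (a <= n)%nat -> exists k : Z, INR (fact n) = IZR k * INR (fact a).
Proof.
  induction 1 as [|n _ [k Hk]]; [exists 1%Z; ring|].
  exists (Z.of_nat (S n) * k)%Z. rewrite INR_fact_S, Hk, mult_IZR, <- INR_IZR_INZ. ring.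
Qed.

Lemma hp_rep_den_S p n r x : (1 <= p)%nat ->
  hp_rep (hp_den p n) r (hp_height p n) x ->
  hp_rep (hp_den p (S n)) r (hp_height p (S n)) x.
Proof.
  intros Hp Hx. pose proof (hp_height_pos p n Hp).
  apply (hp_rep_lin (2 * Z.of_nat p * Z.of_nat (S n)) 0 _ _ _ _ _ _ _ _ _ Hx Hx).
  - rewrite hp_den_S, !mult_IZR, <- !INR_IZR_INZ. ring.
  - rewrite hp_height_S, !mult_IZR, <- !INR_IZR_INZ, Rabs_R0.
    pose proof (pos_INR p). pose proof (pos_INR (S n)).
    rewrite Rabs_pos_eq by nra.
    assert (0 <= INR p * INR (S n) * hp_height p n); [|nra].
    apply Rmult_le_pos; nra.
Qed.

(** One step of the recurrences multiplies the coefficients by at most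
    (2b + 1)p + m <= 12(b + 1)p, which is the ratio of consecutive heights. *)
Lemma hp_base p m b : (1 <= p)%nat -> (m <= 9 * p)%nat ->
  let r := INR m / INR p in
  exists x y, is_series (hp_term 0 b r) x /\ is_series (hp_term 1 b r) y /\
    hp_rep (hp_den p b) r (hp_height p b) x /\
    hp_rep (hp_den p b) r (hp_height p b) y.
Proof.
  intros Hp Hm r. induction b as [|b (x & y & Sx & Sy & Rx & Ry)].
  - exists (cos r), (sin r). split; [apply hp_series_0_0|]. split; [apply hp_series_1_0|].
    unfold hp_den, hp_height. simpl. split.
    + exists 0%Z, 1%Z, 0%Z. rewrite Rabs_R0, Rabs_R1. split; [ring|lra].
    + exists 0%Z, 0%Z, 1%Z. rewrite Rabs_R0, Rabs_R1. split; [ring|lra].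
  - assert (Hb : 0 < INR (S b)) by (apply lt_0_INR; lia).
    assert (Hp' : 0 < INR p) by (apply lt_0_INR; lia).
    pose proof (hp_height_pos p b Hp) as Hh.
    pose proof (le_INR _ _ Hm) as Hm'. rewrite mult_INR in Hm'. simpl (INR 9) in Hm'.
    pose proof (pos_INR m) as Hm0. pose proof (pos_INR b) as Hb0.
    eexists. eexists.
    split; [exact (hp_series_0_S b r y Sy)|]. split; [exact (hp_series_1_S b r y x Sy Sx)|].
    assert (0 <= INR p * hp_height p b * INR b) by (apply Rmult_le_pos; nra).
    assert (INR m * hp_height p b <= 9 * (INR p * hp_height p b)) by nra.
    split.
    + apply (hp_rep_lin (Z.of_nat m) 0 _ _ _ _ _ _ _ _ _ Ry Ry).
      * rewrite hp_den_S, <- INR_IZR_INZ. unfold r. field. lra.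
      * rewrite hp_height_S, <- INR_IZR_INZ, Rabs_R0, Rabs_pos_eq, (S_INR b) by easy. nra.
    + apply (hp_rep_lin (Z.of_nat ((2 * b + 1) * p)) (- Z.of_nat m) _ _ _ _ _ _ _ _ _ Ry Rx).
      * rewrite hp_den_S, opp_IZR, <- !INR_IZR_INZ, mult_INR. unfold r. field. lra.
      * rewrite hp_height_S, opp_IZR, <- !INR_IZR_INZ, Rabs_Ropp, !Rabs_pos_eq by apply pos_INR.
        rewrite mult_INR, plus_INR, mult_INR, (S_INR b). simpl (INR 2). simpl (INR 1).
        assert (0 < INR p * hp_height p b) by nra. nra.
Qed.

(** Going up by two in a costs no new denominator, so all indices a, b <= n share the
    denominator of level n; the coefficients at most double with each unit of a + b. *)
Lemma hp_rep_all p m n : (1 <= p)%nat -> (m <= 9 * p)%nat ->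
  let r := INR m / INR p in
  forall b, (b <= n)%nat -> forall a, (a <= n)%nat ->
  exists x, is_series (hp_term a b r) x /\
    hp_rep (hp_den p n) r (2 ^ (a + b) * hp_height p n) x.
Proof.
  intros Hp Hm r.
  assert (Hp' : 0 < INR p) by (apply lt_0_INR; lia).
  assert (Hbase : forall b, (b <= n)%nat -> exists x y,
    is_series (hp_term 0 b r) x /\ is_series (hp_term 1 b r) y /\
    hp_rep (hp_den p n) r (hp_height p n) x /\ hp_rep (hp_den p n) r (hp_height p n) y).
  { intros b Hb. destruct (hp_base p m b Hp Hm) as (x & y & Sx & Sy & Rx & Ry).
    exists x, y. split; [easy|]. split; [easy|].
    clear Sx Sy. revert x y Rx Ry.
    induction Hb as [|n Hb IH]; [easy|].
    intros x y Rx Ry. destruct (IH x y Rx Ry) as [Rx' Ry'].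
    split; now apply hp_rep_den_S. }
  pose proof (hp_height_pos p n Hp) as Hh.
  assert (H2 : forall k, 1 <= 2 ^ k) by (intros k; apply pow_R1_Rle; lra).
  assert (Hint : forall a, (a <= n)%nat ->
    hp_rep (hp_den p n) r 0 (r ^ a / INR (fact a))).
  { intros a Ha. destruct (INR_fact_div a n Ha) as [k Hk].
    (* The quotient of n! by a! is the integer k. *)
    apply (hp_rep_int (2 ^ Z.of_nat n * Z.of_nat p ^ Z.of_nat (n - a) * k * Z.of_nat m ^ Z.of_nat a)).
    unfold hp_den, r. rewrite Hk, !mult_IZR, <- !pow_IZR, <- !INR_IZR_INZ.
    unfold Rdiv. rewrite !Rpow_mult_distr, pow_inv.
    replace (INR p ^ n) with (INR p ^ (n - a) * INR p ^ a) by (rewrite <- pow_add; f_equal; lia).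
    pose proof (INR_fact_neq_0 a). field. split; [easy|]. apply pow_nonzero. lra. }
  induction b as [|b IHb]; intros Hb.
  - assert (HP : forall a,
      ((a <= n)%nat -> exists x, is_series (hp_term a 0 r) x /\ hp_rep (hp_den p n) r (2 ^ (a + 0) * hp_height p n) x) /\
      ((S a <= n)%nat -> exists x, is_series (hp_term (S a) 0 r) x /\ hp_rep (hp_den p n) r (2 ^ (S a + 0) * hp_height p n) x)).
    { destruct (Hbase 0%nat Hb) as (x & y & Sx & Sy & Rx & Ry).
      induction a as [|a [IH1 IH2]].
      - split; intros _.
        + exists x. split; [easy|]. simpl. now rewrite Rmult_1_l.
        + exists y. split; [easy|]. simpl. revert Ry. apply hp_rep_weaken. lra.
      - split; [easy|]. intros Ha. destruct IH1 as (z & Sz & Rz); [lia|].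
        eexists. split; [exact (hp_series_SS_0 a r z Sz)|].
        apply (hp_rep_lin 1 (-1) _ _ _ _ _ _ _ _ _ (Hint a ltac:(lia)) Rz); [ring|].
        rewrite Rmult_0_r, Rplus_0_l, Rabs_m1, Rmult_1_l.
        apply Rmult_le_compat_r; [lra|]. apply Rle_pow; [lra|lia]. }
    intros a Ha. now apply HP.
  - assert (HP : forall a,
      ((a <= n)%nat -> exists x, is_series (hp_term a (S b) r) x /\ hp_rep (hp_den p n) r (2 ^ (a + S b) * hp_height p n) x) /\
      ((S a <= n)%nat -> exists x, is_series (hp_term (S a) (S b) r) x /\ hp_rep (hp_den p n) r (2 ^ (S a + S b) * hp_height p n) x)).
    { destruct (Hbase (S b) Hb) as (x & y & Sx & Sy & Rx & Ry).
      induction a as [|a [IH1 IH2]].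
      - split; intros _; [exists x|exists y]; (split; [easy|]);
          [revert Rx|revert Ry]; apply hp_rep_weaken;
          rewrite <- (Rmult_1_l (hp_height p n)) at 1; apply Rmult_le_compat_r; auto; lra.
      - split; [easy|]. intros Ha. destruct IH1 as (z & Sz & Rz); [lia|].
        destruct (IHb ltac:(lia) (S (S a)) Ha) as (w & Sw & Rw).
        eexists. split; [exact (hp_series_SS_S a b r w z Sw Sz)|].
        apply (hp_rep_lin 1 (-1) _ _ _ _ _ _ _ _ _ Rw Rz); [ring|].
        rewrite Rabs_m1, Rabs_R1.
        replace (S (S a) + b)%nat with (S (a + S b)) by lia.
        replace (S (S a) + S b)%nat with (S (S (a + S b))) by lia.
        rewrite <- !tech_pow_Rmult. specialize (H2 (a + S b)%nat). nra. }
    intros a Ha. now apply HP.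
Qed.

(** * An irrationality measure: the sine at half-integers *)

Lemma fact_le_pow n N : (n <= N)%nat -> INR (fact n) <= INR N ^ n.
Proof.
  intros H. induction n as [|n IH]; [simpl; lra|].
  rewrite INR_fact_S, <- tech_pow_Rmult.
  apply Rmult_le_compat; [apply pos_INR|apply pos_INR|now apply le_INR|apply IH; lia].
Qed.

Lemma fact_add_ge n k : INR (fact n) * INR n ^ k <= INR (fact (n + k)).
Proof.
  induction k as [|k IH]; [rewrite Nat.add_0_r; simpl; lra|].
  replace (n + S k)%nat with (S (n + k)) by lia.
  rewrite INR_fact_S, <- tech_pow_Rmult.
  assert (INR n <= INR (S (n + k))) by (apply le_INR; lia).
  pose proof (pos_INR n).
  assert (0 <= INR (fact n) * INR n ^ k)
    by (apply Rmult_le_pos; [apply pos_INR|now apply pow_le]).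
  nra.
Qed.

Lemma sin_abs_le x : Rabs (sin x) <= Rabs x.
Proof.
  destruct (MVT_gen sin 0 x cos) as (c & _ & Hc).
  - intros; auto_derive; [easy|ring].
  - intros y _. apply continuity_pt_filterlim, continuous_sin.
  - rewrite sin_0, !Rminus_0_r in Hc. rewrite Hc, Rabs_mult.
    rewrite <- (Rmult_1_l (Rabs x)) at 2.
    apply Rmult_le_compat_r; [apply Rabs_pos|].
    apply Rabs_le, COS_bound.
Qed.

Lemma cos_sub_1_abs_le x : Rabs (cos x - 1) <= Rabs x.
Proof.
  destruct (MVT_gen cos 0 x (fun y => - sin y)) as (c & _ & Hc).
  - intros; auto_derive; [easy|ring].
  - intros y _. apply continuity_pt_filterlim, continuous_cos.
  - rewrite cos_0, !Rminus_0_r in Hc. rewrite Hc, Rabs_mult.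
    rewrite <- (Rmult_1_l (Rabs x)) at 2.
    apply Rmult_le_compat_r; [apply Rabs_pos|].
    rewrite Rabs_Ropp. apply Rabs_le, SIN_bound.
Qed.

(** The quantity is at most (4/3) (2 p 9^3/n^2)^n, because (3n)! >= n! n^(2n).  Since
    n^2 = 6400 s^2 >= 6400 p, the base is less than 1/4. *)
Lemma hp_den_size p s : (1 <= p)%nat -> (p <= s * s)%nat ->
  let n := (80 * s)%nat in
  forall r, 0 <= r <= 9 ->
  hp_den p n * (4 / 3 * (r ^ (3 * n) / INR (fact (3 * n)))) <= / 2.
Proof.
  intros Hp Hs n r Hr. unfold hp_den.
  assert (Hs1 : (1 <= s)%nat) by nia.
  assert (Hn : 0 < INR n) by (apply lt_0_INR; lia).
  pose proof (fact_add_ge n (2 * n)) as Hf.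
  replace (n + 2 * n)%nat with (3 * n)%nat in Hf by lia.
  pose proof (INR_fact_lt_0 n) as Hfn. pose proof (INR_fact_lt_0 (3 * n)) as Hf3.
  assert (Hpow : 0 < INR n ^ (2 * n)) by now apply pow_lt.
  assert (Hq : INR (fact n) / INR (fact (3 * n)) <= / INR n ^ (2 * n)).
  { apply Rle_div_l; [easy|]. apply Rmult_le_reg_r with (INR n ^ (2 * n)); [easy|].
    replace (/ INR n ^ (2 * n) * INR (fact (3 * n)) * INR n ^ (2 * n)) with (INR (fact (3 * n)))
      by (field; lra). easy. }
  assert (Hr3 : r ^ (3 * n) <= 9 ^ (3 * n)) by now apply pow_incr.
  pose proof (pos_INR p) as Hp0.
  assert (Hbase : 2 * INR p * 9 ^ 3 * / INR n ^ 2 <= / 4).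
  { apply Rle_div_l; [apply pow_lt; lra|].
    apply le_INR in Hs. rewrite mult_INR in Hs.
    unfold n. rewrite mult_INR. replace (INR 80) with 80 by (rewrite INR_IZR_INZ; easy).
    nra. }
  assert (Hmain : (2 * INR p * 9 ^ 3 * / INR n ^ 2) ^ n <= / 4).
  { replace n with (S (n - 1)) at 2 by lia. rewrite <- tech_pow_Rmult.
    assert (0 <= 2 * INR p * 9 ^ 3 * / INR n ^ 2).
    { apply Rmult_le_pos; [lra|]. left. apply Rinv_0_lt_compat, pow_lt. lra. }
    assert ((2 * INR p * 9 ^ 3 * / INR n ^ 2) ^ (n - 1) <= 1 ^ (n - 1)) by (apply pow_incr; lra).
    rewrite pow1 in *. assert (0 <= (2 * INR p * 9 ^ 3 * / INR n ^ 2) ^ (n - 1)) by now apply pow_le.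
    nra. }
  rewrite !Rpow_mult_distr, pow_inv, <- !pow_mult in Hmain.
  replace ((2 * INR p) ^ n * INR (fact n) * (4 / 3 * (r ^ (3 * n) / INR (fact (3 * n)))))
    with (4 / 3 * ((2 * INR p) ^ n * r ^ (3 * n) * (INR (fact n) / INR (fact (3 * n))))) by (field; lra).
  rewrite Rpow_mult_distr.
  assert (H2p : 0 <= 2 ^ n * INR p ^ n) by (apply Rmult_le_pos; apply pow_le; lra).
  assert (2 ^ n * INR p ^ n * r ^ (3 * n) * (INR (fact n) / INR (fact (3 * n)))
    <= 2 ^ n * INR p ^ n * 9 ^ (3 * n) * / INR n ^ (2 * n)); [|lra].
  apply Rmult_le_compat; try easy.
  - apply Rmult_le_pos; [easy|apply pow_le; lra].
  - apply Rdiv_le_0_compat; lra.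
  - now apply Rmult_le_compat_l.
Qed.

(** Multiplied by [hp_den p n], the form of indices a = b = n is an integer up to an error
    of at most 2 H |r - 2 pi|, where H bounds its coefficients.  It is at most 1/2, and
    has an explicit positive lower bound.  If the integer is 0 the error is the whole
    form; otherwise the error is at least 1/2.  Either way |r - 2 pi| cannot be too small. *)
Lemma two_pi_rational_gap p m s : (1 <= p)%nat -> (p <= s * s)%nat ->
  let n := (80 * s)%nat in
  let r := INR m / INR p in
  1 <= r <= 9 ->
  / (4 * (2 ^ (2 * n) * hp_height p n) * INR (fact (3 * n))) <= Rabs (r - 2 * PI).
Proof.
  intros Hp Hs n r Hr.
  assert (Hs1 : (1 <= s)%nat) by nia.
  assert (Hp' : 0 < INR p) by (apply lt_0_INR; lia).
  assert (Hm : (m <= 9 * p)%nat).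
  { apply INR_le. rewrite mult_INR. replace (INR 9) with 9 by (simpl; ring).
    apply Rle_div_l; [easy|]. apply Hr. }
  destruct (hp_rep_all p m n Hp Hm n (le_n n) n (le_n n)) as (y & Sy & al & be & ga & E & Hbe & Hga).
  fold r in Sy, E. replace (n + n)%nat with (2 * n)%nat in Hbe, Hga by lia.
  set (H := 2 ^ (2 * n) * hp_height p n) in *.
  assert (Hden : 1 <= hp_den p n).
  { unfold hp_den. rewrite <- (Rmult_1_l 1). apply (le_INR 1) in Hp. simpl in Hp.
    apply Rmult_le_compat; try lra.
    - apply pow_R1_Rle. lra.
    - apply (le_INR 1), lt_O_fact. }
  assert (HH : 1 <= H).
  { unfold H. rewrite <- (Rmult_1_l 1). apply Rmult_le_compat; try lra.
    - apply pow_R1_Rle. lra.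
    - unfold hp_height. rewrite <- (Rmult_1_l 1). apply (le_INR 1) in Hp. simpl in Hp.
      apply Rmult_le_compat; try lra.
      + apply pow_R1_Rle. lra.
      + apply (le_INR 1), lt_O_fact. }
  pose proof (hp_size n r y ltac:(lia) Hr Sy) as [Hlo Hhi].
  pose proof (hp_den_size p s Hp Hs r ltac:(lra)) as Hsm. fold n in Hsm.
  assert (HF : 1 <= INR (fact (3 * n))) by (apply (le_INR 1), lt_O_fact).
  assert (Hr3 : 1 <= r ^ (3 * n)) by (apply pow_R1_Rle; lra).
  set (F := INR (fact (3 * n))) in *.
  assert (Hlow : 2 / 3 * / F <= hp_den p n * y).
  { assert (0 < / F) by (apply Rinv_0_lt_compat; lra).
    assert (/ F <= r ^ (3 * n) / F) by (unfold Rdiv; nra). nra. }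
  assert (Hup : hp_den p n * y <= / 2) by nra.
  set (d := Rabs (r - 2 * PI)).
  (* the integer obtained by pretending that cos r = 1 and sin r = 0 *)
  assert (Herr : Rabs (hp_den p n * y - IZR (al + be)) <= 2 * H * d).
  { rewrite E, plus_IZR.
    replace (IZR al + IZR be * cos r + IZR ga * sin r - (IZR al + IZR be))
      with (IZR be * (cos (r - 2 * PI) - 1) + IZR ga * sin (r - 2 * PI)).
    - eapply Rle_trans; [apply Rabs_triang|]. rewrite !Rabs_mult.
      pose proof (cos_sub_1_abs_le (r - 2 * PI)). pose proof (sin_abs_le (r - 2 * PI)).
      fold d in H0, H1.
      assert (Rabs (IZR be) * Rabs (cos (r - 2 * PI) - 1) <= H * d)
        by (apply Rmult_le_compat; auto; apply Rabs_pos).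
      assert (Rabs (IZR ga) * Rabs (sin (r - 2 * PI)) <= H * d)
        by (apply Rmult_le_compat; auto; apply Rabs_pos).
      lra.
    - rewrite cos_minus, sin_minus, cos_2PI, sin_2PI. ring. }
  assert (HiF : / F <= 1) by (rewrite <- Rinv_1; apply Rinv_le_contravar; lra).
  assert (Hgap : / 2 * / F <= 2 * H * d).
  (* A vanishing integer is not excluded; the lower bound of the form covers it. *)
  { destruct (Z.eq_dec (al + be) 0) as [Hz|Hz].
    - rewrite Hz, Rminus_0_r in Herr. pose proof (Rle_abs (hp_den p n * y)).
      assert (0 < / F) by (apply Rinv_0_lt_compat; lra). lra.
    - assert (1 <= Rabs (IZR (al + be))) by (rewrite <- abs_IZR; apply IZR_le; lia).
      pose proof (Rabs_triang (hp_den p n * y) (- (hp_den p n * y - IZR (al + be)))) as Ht.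
      replace (hp_den p n * y + - (hp_den p n * y - IZR (al + be))) with (IZR (al + be)) in Ht by ring.
      rewrite Rabs_Ropp in Ht.
      assert (0 < / F) by (apply Rinv_0_lt_compat; lra).
      rewrite (Rabs_pos_eq (hp_den p n * y)) in Ht by lra. lra. }
  rewrite !Rinv_mult.
  apply Rmult_le_reg_l with (4 * H); [lra|].
  replace (4 * H * (/ 4 * / H * / F)) with (/ F) by (field; lra). lra.
Qed.

Lemma hp_gap_explicit p s : (1 <= p)%nat -> (p <= s * s)%nat ->
  let n := (80 * s)%nat in
  4 * (2 ^ (2 * n) * hp_height p n) * INR (fact (3 * n)) <= INR (10 * n) ^ (6 * n).
Proof.
  intros Hp Hs n.
  assert (Hs1 : (1 <= s)%nat) by nia.
  assert (Hn : 1 <= INR n) by (apply (le_INR 1); lia).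
  assert (Hpn : INR p <= INR n * INR n).
  { rewrite <- mult_INR. apply le_INR. unfold n. nia. }
  pose proof (pos_INR p) as Hp0.
  assert (H1 : hp_height p n <= (12 * INR n ^ 2) ^ n * INR n ^ n).
  { unfold hp_height. apply Rmult_le_compat.
    - apply pow_le. lra.
    - apply pos_INR.
    - apply pow_incr. simpl. lra.
    - now apply fact_le_pow. }
  assert (H2 : INR (fact (3 * n)) <= (3 * INR n) ^ (3 * n)).
  { replace (3 * INR n) with (INR (3 * n)) by (rewrite mult_INR; simpl; ring). now apply fact_le_pow. }
  assert (H3 : 4 <= 4 ^ n).
  { replace n with (S (n - 1)) by lia. rewrite <- tech_pow_Rmult.
    assert (1 <= 4 ^ (n - 1)) by (apply pow_R1_Rle; lra). lra. }
  pose proof (hp_height_pos p n Hp) as Hh.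
  rewrite mult_INR. replace (INR 10) with 10 by (simpl; ring).
  replace (6 * n)%nat with ((2 + 1 + 3) * n)%nat by lia.
  rewrite (pow_mult (10 * INR n)).
  apply Rle_trans with (4 ^ n * (2 ^ (2 * n) * ((12 * INR n ^ 2) ^ n * INR n ^ n)) * (3 * INR n) ^ (3 * n)).
  - apply Rmult_le_compat; [|apply pos_INR| |easy].
    + apply Rmult_le_pos; [lra|]. apply Rmult_le_pos; [apply pow_le; lra|lra].
    + apply Rmult_le_compat; [lra| |easy|].
      * apply Rmult_le_pos; [apply pow_le; lra|lra].
      * apply Rmult_le_compat_l; [apply pow_le; lra|easy].
  - rewrite (pow_mult 2), (pow_mult (3 * INR n)), <- !Rpow_mult_distr. apply pow_incr.
    assert (0 < INR n ^ 6) by (apply pow_lt; lra).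
    replace (4 * (2 ^ 2 * (12 * INR n ^ 2 * INR n)) * (3 * INR n) ^ 3)
      with (5184 * INR n ^ 6) by ring.
    replace ((10 * INR n) ^ (2 + 1 + 3)) with (1000000 * INR n ^ 6)
      by (change (2 + 1 + 3)%nat with 6%nat; ring). lra.
Qed.

Lemma sin_ge_third x : 0 <= x <= PI / 2 -> x / 3 <= sin x.
Proof.
  intros Hx. pose proof PI_4 as H4.
  destruct (pre_sin_bound x 0) as [H _]; [lra|lra|].
  unfold sin_approx, sin_term in H. simpl in H.
  assert (x * x <= 4) by nra.
  assert (x * (x * x) <= x * 4) by (apply Rmult_le_compat_l; lra).
  lra.
Qed.

Lemma Rabs_sin_sub_pi x p : Rabs (sin (x - INR p * PI)) = Rabs (sin x).
Proof.
  induction p as [|p IH].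
  - f_equal. f_equal. simpl. ring.
  - rewrite S_INR. rewrite <- IH.
    replace (x - INR p * PI) with (x - (INR p + 1) * PI + PI) by ring.
    now rewrite neg_sin, Rabs_Ropp.
Qed.

Lemma nearest_pi_multiple x : 0 <= x -> exists p : nat, Rabs (x - INR p * PI) <= PI / 2.
Proof.
  intros Hx. pose proof PI_RGT_0 as Hpi.
  destruct (archimed (x / PI - / 2)) as [H1 H2].
  set (z := up (x / PI - / 2)) in *.
  assert (Hx' : 0 <= x / PI) by now apply Rdiv_le_0_compat.
  assert (Hz : (0 <= z)%Z).
  { apply Z.lt_succ_r. apply lt_IZR. rewrite succ_IZR. lra. }
  exists (Z.to_nat z). rewrite INR_IZR_INZ, Z2Nat.id by easy.
  replace (x - IZR z * PI) with ((x / PI - IZR z) * PI) by (field; lra).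
  rewrite Rabs_mult, (Rabs_pos_eq PI) by lra.
  assert (Rabs (x / PI - IZR z) <= / 2) by (apply Rabs_le; lra). nra.
Qed.

Lemma exp_le x y : x <= y -> exp x <= exp y.
Proof. intros [H|H]; [left; now apply exp_increasing|right; now rewrite H]. Qed.

(** Trades the logarithm in exp(- X ln X), X of order sqrt m, for a power, so that the
    final exponent is a pure power of m. *)
Lemma ln_le_cbrt X : 0 < X -> ln X <= 3 * Rpower X (/ 3).
Proof.
  intros HX. pose proof (exp_pos (/ 3 * ln X)) as He.
  pose proof (exp_ineq1_le (/ 3 * ln X)). unfold Rpower. lra.
Qed.

(** Let p pi be the multiple of pi nearest to m/2.  If m/2 is not close to p pi there
    is nothing to do; otherwise m/p is a rational number close to 2 pi, whose distance to
    2 pi is at least (10n)^(-6n) with n of order sqrt m. *)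
Theorem sin_half_nat_lower_bound :
  exists C, 0 < C /\ forall m : nat, (1 <= m)%nat ->
    exp (- (C * Rpower (INR m) (2 / 3))) <= Rabs (sin (INR m / 2)).
Proof.
  assert (HC : 1600 <= Rpower 1600 (4 / 3)).
  { rewrite <- (Rpower_1 1600) at 1 by lra. apply Rle_Rpower; lra. }
  exists (3 * Rpower 1600 (4 / 3)). split; [lra|]. intros m Hm.
  assert (Hm1 : 1 <= INR m) by now apply (le_INR 1).
  assert (Hm23 : 1 <= Rpower (INR m) (2 / 3)).
  { rewrite <- (Rpower_O (INR m)) at 1 by lra. apply Rle_Rpower; lra. }
  assert (Htriv : exp (- (3 * Rpower 1600 (4 / 3) * Rpower (INR m) (2 / 3))) <= / 12).
  { apply Rle_trans with (exp (- 12)).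
    - apply exp_le. nra.
    - replace (-12) with (- (12)) by lra. rewrite exp_Ropp. apply Rinv_le_contravar; [lra|]. pose proof (exp_ineq1_le 12). lra. }
  destruct (nearest_pi_multiple (INR m / 2)) as [p Hp]; [lra|].
  pose proof PI_4 as Hpi4. pose proof PI2_3_2 as Hpi3.
  set (x := INR m / 2 - INR p * PI) in *.
  assert (Hsin : Rabs x / 3 <= Rabs (sin (INR m / 2))).
  { rewrite <- (Rabs_sin_sub_pi _ p). fold x.
    destruct (Rle_dec 0 x) as [H0|H0].
    - rewrite (Rabs_pos_eq x) in * by easy.
      eapply Rle_trans; [apply sin_ge_third; lra|apply Rle_abs].
    - rewrite (Rabs_left x) in * by lra. rewrite <- Rabs_Ropp, <- sin_neg.
      eapply Rle_trans; [apply sin_ge_third; lra|apply Rle_abs]. }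
  destruct (Rle_dec (/ 4) (Rabs x)) as [Hbig|Hsmall]; [lra|].
  apply Rnot_le_lt in Hsmall.
  assert (Hp1 : (1 <= p)%nat).
  { destruct p; [|lia]. exfalso. unfold x in Hsmall. simpl (INR 0) in Hsmall.
    rewrite Rmult_0_l, Rminus_0_r, Rabs_pos_eq in Hsmall; lra. }
  assert (HpR : 1 <= INR p) by now apply (le_INR 1).
  set (r := INR m / INR p).
  assert (Hrx : r - 2 * PI = 2 * x / INR p) by (unfold r, x; field; lra).
  assert (Hrd : Rabs (r - 2 * PI) <= 2 * Rabs x).
  { rewrite Hrx. unfold Rdiv. rewrite !Rabs_mult, (Rabs_pos_eq 2) by lra.
    assert (Rabs (/ INR p) <= 1).
    { rewrite Rabs_pos_eq; [rewrite <- Rinv_1; apply Rinv_le_contravar; lra|].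
      left. apply Rinv_0_lt_compat. lra. }
    pose proof (Rabs_pos x). nra. }
  assert (Hr : 1 <= r <= 9).
  { assert (Hb : Rabs (r - 2 * PI) <= / 2) by lra. apply Rabs_le_between in Hb. lra. }
  assert (Hpm : (p <= m)%nat).
  { apply INR_le. destruct Hr as [Hr _]. unfold r in Hr. apply Rle_div_r in Hr; lra. }
  (* Any s with p <= s^2 will do; this one is at most 2 sqrt m. *)
  set (s := S (Nat.sqrt m)).
  assert (Hs : (m <= s * s)%nat).
  { destruct (Nat.sqrt_spec m) as [_ H]; [lia|]. unfold s. lia. }
  pose proof (two_pi_rational_gap p m s Hp1 ltac:(lia) Hr) as Hgap. fold r in Hgap.
  pose proof (hp_gap_explicit p s Hp1 ltac:(lia)) as Hexp.
  set (n := (80 * s)%nat) in *.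
  set (X := INR (10 * n)).
  assert (HX6 : 6 <= X) by (replace 6 with (INR 6) by (simpl; ring); apply le_INR; unfold n, s; lia).
  set (Y := 4 * (2 ^ (2 * n) * hp_height p n) * INR (fact (3 * n))) in *. cbv zeta in Hgap, Hexp.
  fold Y in Hgap, Hexp. fold X in Hexp.
  assert (HY : 0 < Y).
  { unfold Y. apply Rmult_lt_0_compat; [|apply INR_fact_lt_0].
    apply Rmult_lt_0_compat; [lra|]. apply Rmult_lt_0_compat; [apply pow_lt; lra|now apply hp_height_pos]. }
  assert (Hlow : / X ^ (10 * n) <= Rabs (sin (INR m / 2))).
  { apply Rle_trans with (/ (6 * Y)).
    - apply Rinv_le_contravar; [lra|].
      apply Rle_trans with (X ^ S (6 * n)).
      + rewrite <- tech_pow_Rmult. apply Rmult_le_compat; lra.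
      + apply Rle_pow; [lra|unfold n, s; lia].
    - rewrite Rinv_mult. lra. }
  eapply Rle_trans; [|exact Hlow].
  rewrite <- Rpower_pow by lra. unfold Rpower at 3. rewrite <- exp_Ropp. apply exp_le.
  apply Ropp_le_contravar. fold X.
  assert (HXm : X <= 1600 * sqrt (INR m)).
  { assert (Hq : INR (Nat.sqrt m) <= sqrt (INR m)).
    { rewrite <- (sqrt_square (INR (Nat.sqrt m))) by apply pos_INR.
      apply sqrt_le_1_alt. rewrite <- mult_INR. apply le_INR.
      destruct (Nat.sqrt_spec m) as [H _]; [lia|]. exact H. }
    assert (1 <= sqrt (INR m)) by (rewrite <- sqrt_1; apply sqrt_le_1_alt; lra).
    unfold X, n, s. rewrite !mult_INR, (S_INR (Nat.sqrt m)).
    replace (INR 10) with 10 by (simpl; ring).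
    replace (INR 80) with 80 by (rewrite INR_IZR_INZ; easy). lra. }
  apply Rle_trans with (X * (3 * Rpower X (/ 3))).
  - apply Rmult_le_compat_l; [lra|]. apply ln_le_cbrt. lra.
  - replace (X * (3 * Rpower X (/ 3))) with (3 * Rpower X (4 / 3)).
    + rewrite Rmult_assoc. apply Rmult_le_compat_l; [lra|].
      apply Rle_trans with (Rpower (1600 * sqrt (INR m)) (4 / 3)).
      * apply Rle_Rpower_l; lra.
      * rewrite <- Rpower_mult_distr; [|lra|apply sqrt_lt_R0; lra].
        rewrite <- (Rpower_sqrt (INR m)) by lra. rewrite Rpower_mult.
        right. f_equal. f_equal. lra.
    + rewrite <- (Rpower_1 X) at 2 by lra.
      replace (Rpower X 1 * (3 * Rpower X (/ 3))) with (3 * (Rpower X 1 * Rpower X (/ 3))) by ring.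
      rewrite <- Rpower_plus. f_equal. f_equal. lra.
Qed.

(** * Finite sums and condensation *)

(** Sum over i < n; it starts from the empty sum, contrary to [sum_n]. *)
Fixpoint psum (a : nat -> R) (n : nat) : R :=
  match n with O => 0 | S n => psum a n + a n end.

Lemma psum_S a n : psum a (S n) = psum a n + a n.
Proof. easy. Qed.

Lemma sum_n_psum a n : sum_n a n = psum a (S n).
Proof.
  induction n as [|n IH].
  - rewrite sum_O. symmetry. apply Rplus_0_l.
  - rewrite sum_Sn, IH. reflexivity.
Qed.

Lemma psum_add a m n : psum a (m + n) = psum a m + psum (fun i => a (m + i)%nat) n.
Proof.
  induction n as [|n IH]; [rewrite Nat.add_0_r; simpl; ring|].
  rewrite Nat.add_succ_r. simpl. rewrite IH. ring.
Qed.

Lemma psum_le a b n : (forall i, (i < n)%nat -> a i <= b i) -> psum a n <= psum b n.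
Proof.
  intros H. induction n as [|n IH]; simpl; [lra|].
  apply Rplus_le_compat; [apply IH; intros i Hi; apply H; lia|apply H; lia].
Qed.

Lemma psum_nonneg a n : (forall i, (i < n)%nat -> 0 <= a i) -> 0 <= psum a n.
Proof.
  intros H. induction n as [|n IH]; simpl; [lra|].
  apply Rplus_le_le_0_compat; [apply IH; intros i Hi; apply H; lia|apply H; lia].
Qed.

Lemma psum_zero a n : (forall i, (i < n)%nat -> a i = 0) -> psum a n = 0.
Proof.
  intros H. induction n as [|n IH]; [easy|].
  rewrite psum_S, IH by (intros; apply H; lia). rewrite H by lia. ring.
Qed.

Lemma psum_const_plus_scal c d a n :
  psum (fun i => c + d * a i) n = INR n * c + d * psum a n.
Proof.
  induction n as [|n IH]; [simpl; ring|].
  rewrite S_INR. simpl. rewrite IH. ring.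
Qed.

Lemma psum_mono a m n : (forall i, 0 <= a i) -> (m <= n)%nat -> psum a m <= psum a n.
Proof.
  intros H Hmn. replace n with (m + (n - m))%nat by lia. rewrite psum_add.
  assert (0 <= psum (fun i => a (m + i)%nat) (n - m)) by (apply psum_nonneg; auto). lra.
Qed.

Lemma ex_series_psum_bounded a M :
  (forall i, 0 <= a i) -> (forall n, psum a n <= M) -> ex_series a.
Proof.
  intros Ha HM.
  destruct (ex_finite_lim_seq_incr (sum_n a) M) as [l Hl].
  - intros n. rewrite sum_Sn. unfold plus; simpl. specialize (Ha (S n)). lra.
  - intros n. rewrite sum_n_psum. apply HM.
  - now exists l.
Qed.

Lemma psum_le_Series a n : (forall i, 0 <= a i) -> ex_series a -> psum a n <= Series a.
Proof.
  intros Ha Hex. apply Series_correct in Hex.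
  apply is_lim_seq_incr_compare with (n := n) in Hex.
  - rewrite sum_n_psum in Hex. specialize (Ha n). simpl in Hex. lra.
  - intros k. rewrite sum_Sn. unfold plus; simpl. specialize (Ha (S k)). lra.
Qed.

(** Cauchy condensation, with bounds on the sums over dyadic blocks in the place of
    monotonicity. *)
Lemma ex_series_dyadic (a B : nat -> R) (J : nat) :
  (forall i, 0 <= a i) -> (forall j, 0 <= B j) -> ex_series B ->
  (forall j, (J <= j)%nat -> psum (fun i => a (2 ^ j + i)%nat) (2 ^ j) <= B j) ->
  ex_series a.
Proof.
  intros Ha HB HBs Hblock.
  assert (H : forall j, psum a (2 ^ (J + j)) <= psum a (2 ^ J) + psum B (J + j)).
  { induction j as [|j IH].
    - rewrite Nat.add_0_r. assert (0 <= psum B J) by (apply psum_nonneg; auto). lra.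
    - rewrite Nat.add_succ_r, Nat.pow_succ_r'.
      replace (2 * 2 ^ (J + j))%nat with (2 ^ (J + j) + 2 ^ (J + j))%nat by lia.
      rewrite psum_add. simpl psum. specialize (Hblock (J + j)%nat ltac:(lia)). lra. }
  apply ex_series_psum_bounded with (psum a (2 ^ J) + Series B); [easy|].
  intros n. apply Rle_trans with (psum a (2 ^ (J + n))).
  - apply psum_mono; [easy|].
    assert (n < 2 ^ n)%nat by (apply Nat.pow_gt_lin_r; lia).
    assert (2 ^ n <= 2 ^ (J + n))%nat by (apply Nat.pow_le_mono_r; lia). lia.
  - pose proof (psum_le_Series B (J + n) HB HBs). specialize (H n). lra.
Qed.

(** Telescoping: 1/x^(3/2) <= 2/sqrt(x - 1) - 2/sqrt x. *)
Lemma ex_series_inv_pow_3_2 : ex_series (fun j => / (INR j * sqrt (INR j))).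
Proof.
  apply ex_series_incr_1.
  assert (Hpos : forall j, 0 < sqrt (INR (S j))).
  { intros j. apply sqrt_lt_R0, lt_0_INR. lia. }
  apply ex_series_psum_bounded with 3.
  - intros j. left. apply Rinv_0_lt_compat, Rmult_lt_0_compat; [apply lt_0_INR; lia|easy].
  - assert (H : forall n, psum (fun j => / (INR (S j) * sqrt (INR (S j)))) (S n) <= 3 - 2 / sqrt (INR (S n))).
    { induction n as [|n IH].
      - simpl. rewrite sqrt_1. lra.
      - change (psum (fun j => / (INR (S j) * sqrt (INR (S j)))) (S n) +
          / (INR (S (S n)) * sqrt (INR (S (S n)))) <= 3 - 2 / sqrt (INR (S (S n)))).
        set (u := sqrt (INR (S n))) in *. set (v := sqrt (INR (S (S n)))).
        assert (Hu : 0 < u) by apply Hpos. assert (Hv : 0 < v) by apply Hpos.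
        assert (Eu : u * u = INR (S n)) by apply sqrt_sqrt, pos_INR.
        assert (Ev : v * v = INR (S (S n))) by apply sqrt_sqrt, pos_INR.
        rewrite <- Ev. rewrite (S_INR (S n)), <- Eu in Ev.
        assert (Huv : u <= v) by nra.
        assert (Hd : 2 / u - 2 / v = 2 / (u * v * (u + v))).
        { replace (2 / u - 2 / v) with (2 * ((v - u) * (u + v)) / (u * v * (u + v))) by (field; lra).
          f_equal. replace ((v - u) * (u + v)) with (v * v - u * u) by ring. lra. }
        assert (/ (v * v * v) <= 2 / (u * v * (u + v))); [|lra].
        assert (0 < u * v) by now apply Rmult_lt_0_compat.
        assert (0 < u * v * (u + v)) by (apply Rmult_lt_0_compat; lra).
        assert (0 < v * v) by now apply Rmult_lt_0_compat.
        assert (0 < v * v * v) by now apply Rmult_lt_0_compat.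
        replace (2 / (u * v * (u + v))) with (/ (u * v * (u + v) / 2)) by (field; lra).
        apply Rinv_le_contravar; [lra|].
        assert (u * v * (u + v) <= v * v * (v + v)) by (apply Rmult_le_compat; nra). lra. }
    intros [|n]; [simpl; lra|]. specialize (H n).
    assert (0 < 2 / sqrt (INR (S n))) by (apply Rdiv_lt_0_compat; [lra|easy]). lra.
Qed.

(** * Sets of integers with gaps *)

Definition indicator (P : nat -> bool) (i : nat) : R := if P i then 1 else 0.

(** Two elements in the window would be closer than M. *)
Lemma window_count (P : nat -> bool) (M s L : nat) :
  (L <= M)%nat ->
  (forall i i', (i < i')%nat -> P i = true -> P i' = true -> (M <= i' - i)%nat) ->
  psum (fun i => indicator P (s + i)) L <= 1.
Proof.
  intros HL HP.
  assert (H : psum (fun i => indicator P (s + i)) L = 0 \/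
    (psum (fun i => indicator P (s + i)) L = 1 /\ exists i, (i < L)%nat /\ P (s + i)%nat = true)).
  { induction L as [|L IH]; [now left|].
    simpl. unfold indicator at 2 4. destruct (P (s + L)%nat) eqn:E.
    - destruct IH as [IH|[_ (i & Hi & Pi)]]; [lia| |].
      + right. split; [lra|]. exists L. split; [lia|easy].
      + specialize (HP (s + i)%nat (s + L)%nat ltac:(lia) Pi E). lia.
    - destruct IH as [IH|[IH (i & Hi & Pi)]]; [lia|left; lra|right].
      split; [lra|]. exists i. split; [lia|easy]. }
  lra.
Qed.

Lemma gap_count (P : nat -> bool) (M N : nat) :
  (forall i i', (i < i')%nat -> P i = true -> P i' = true -> (M <= i' - i)%nat) ->
  psum (indicator P) (N * M) <= INR N.
Proof.
  intros HP. induction N as [|N IH]; [simpl; lra|].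
  replace (S N * M)%nat with (N * M + M)%nat by lia. rewrite psum_add, S_INR.
  pose proof (window_count P M (N * M) M (le_n M) HP). lra.
Qed.

(** * Summability of the majorant *)

Lemma exp_INR_mult n y : exp (INR n * y) = exp y ^ n.
Proof.
  rewrite <- Rpower_pow by apply exp_pos. unfold Rpower. now rewrite ln_exp.
Qed.

Lemma exp_INR n : exp (INR n) = exp 1 ^ n.
Proof. now rewrite <- exp_INR_mult, Rmult_1_r. Qed.

(** Half of |e^{ik} - 1|; small exactly when k is close to a multiple of 2 pi. *)
Definition angle_defect (k : nat) : R := Rabs (sin (INR k / 2)).

(** Majorant, uniform in r < 1, of the contribution of the k-th Fourier coefficient;
    see [bbg_walk_bound]. *)
Definition passage_bound (k : nat) : R :=
  / INR k * exp (- (INR k * sqrt (angle_defect k) / 4)).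

Lemma angle_defect_sub k k' : (k <= k')%nat ->
  angle_defect (k' - k) <= angle_defect k' + angle_defect k.
Proof.
  intros H. unfold angle_defect. rewrite minus_INR by easy.
  replace ((INR k' - INR k) / 2) with (INR k' / 2 - INR k / 2) by lra.
  rewrite sin_minus. unfold Rminus. eapply Rle_trans; [apply Rabs_triang|].
  rewrite Rabs_Ropp, !Rabs_mult.
  pose proof (Rabs_pos (sin (INR k' / 2))). pose proof (Rabs_pos (sin (INR k / 2))).
  assert (forall x, Rabs (cos x) <= 1) as Hc by (intros x; apply Rabs_le, COS_bound).
  pose proof (Hc (INR k / 2)). pose proof (Hc (INR k' / 2)).
  pose proof (Rabs_pos (cos (INR k' / 2))). pose proof (Rabs_pos (cos (INR k / 2))). nra.
Qed.

Lemma near_period_threshold j : (36 <= j)%nat ->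
  32 * INR j ^ 2 / 4 ^ j <= exp (- (INR j / 4)).
Proof.
  intros Hj. assert (HjR : 36 <= INR j).
  { replace 36 with (INR 36) by (rewrite INR_IZR_INZ; easy). now apply le_INR. }
  assert (Hj4 : INR j <= 4 * exp (INR j / 4)).
  { pose proof (exp_ineq1_le (INR j / 4)). lra. }
  assert (Hj2 : INR j ^ 2 <= 16 * exp (INR j / 2)).
  { replace (INR j / 2) with (INR j / 4 + INR j / 4) by lra. rewrite exp_plus. nra. }
  assert (H4 : exp (INR j) <= 4 ^ j).
  { rewrite exp_INR. apply pow_incr. pose proof exp_le_3. pose proof (exp_pos 1). lra. }
  (* The threshold 36 for j comes from here: 36/4 = 9 and 2^9 = 512. *)
  assert (H512 : 512 <= exp (INR j / 4)).
  { apply Rle_trans with (exp 9); [|apply exp_le; lra].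
    replace 9 with (INR 9) by (simpl; ring). rewrite exp_INR.
    replace 512 with (2 ^ 9) by (simpl; lra). apply pow_incr.
    pose proof (exp_ineq1_le 1). lra. }
  apply Rle_div_l; [apply pow_lt; lra|].
  apply Rle_trans with (exp (- (INR j / 4)) * exp (INR j)).
  - replace (exp (- (INR j / 4)) * exp (INR j)) with (exp (INR j / 4) * exp (INR j / 2))
      by (rewrite <- !exp_plus; f_equal; lra).
    pose proof (exp_pos (INR j / 2)). nra.
  - apply Rmult_le_compat_l; [left; apply exp_pos|easy].
Qed.

(** The exceptional k of the block from 2^j to 2^(j+1): for the other ones the
    exponent in [passage_bound] is at most -j. *)
Definition near_period (j k : nat) : Prop := sqrt (angle_defect k) < 4 * INR j / 2 ^ j.

(** The difference of two exceptional numbers is so close to a multiple of 2 pi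
    that the irrationality measure forces it to be large. *)
Lemma near_period_gap : exists c, 0 < c /\ forall j k k', (36 <= j)%nat -> (k < k')%nat ->
  near_period j k -> near_period j k' -> c * (INR j * sqrt (INR j)) <= INR (k' - k).
Proof.
  destruct sin_half_nat_lower_bound as (C & HC & Hlow).
  (* From j/4 <= C m^(2/3). *)
  exists (Rpower (/ (4 * C)) (3 / 2)). split; [apply exp_pos|].
  intros j k k' Hj Hk Bk Bk'.
  assert (Hsmall : forall q, near_period j q -> angle_defect q <= 16 * INR j ^ 2 / 4 ^ j).
  { intros q Bq. unfold near_period in Bq.
    rewrite <- (sqrt_sqrt (angle_defect q)) by apply Rabs_pos.
    pose proof (sqrt_pos (angle_defect q)).
    replace (16 * INR j ^ 2 / 4 ^ j) with (4 * INR j / 2 ^ j * (4 * INR j / 2 ^ j)).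
    - apply Rmult_le_compat; lra.
    - replace (4 ^ j) with (2 ^ j * 2 ^ j) by (rewrite <- Rpow_mult_distr; f_equal; lra). field. apply pow_nonzero. lra. }
  pose proof (angle_defect_sub k k' ltac:(lia)) as Hsub.
  pose proof (Hsmall k Bk). pose proof (Hsmall k' Bk').
  specialize (Hlow (k' - k)%nat ltac:(lia)). fold (angle_defect (k' - k)) in Hlow.
  pose proof (near_period_threshold j Hj) as Hth.
  assert (HjR : 36 <= INR j).
  { replace 36 with (INR 36) by (rewrite INR_IZR_INZ; easy). now apply le_INR. }
  set (m := (k' - k)%nat) in *.
  assert (Hm : 1 <= INR m) by (apply (le_INR 1); unfold m; lia).
  assert (He : exp (- (C * Rpower (INR m) (2 / 3))) <= exp (- (INR j / 4))) by lra.
  assert (Hle : INR j / 4 <= C * Rpower (INR m) (2 / 3)).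
  { apply Rnot_lt_le. intros Hlt.
    assert (exp (- (INR j / 4)) < exp (- (C * Rpower (INR m) (2 / 3)))) by (apply exp_increasing; lra).
    lra. }
  assert (Hle' : / (4 * C) * INR j <= Rpower (INR m) (2 / 3)).
  { apply Rmult_le_reg_l with C; [easy|]. replace (C * (/ (4 * C) * INR j)) with (INR j / 4) by (field; lra).
    easy. }
  assert (H4C : 0 < / (4 * C)) by (apply Rinv_0_lt_compat; lra).
  replace (INR m) with (Rpower (Rpower (INR m) (2 / 3)) (3 / 2)).
  2: { rewrite Rpower_mult. replace (2 / 3 * (3 / 2)) with 1 by lra. apply Rpower_1. lra. }
  replace (INR j * sqrt (INR j)) with (Rpower (INR j) (3 / 2)).
  2: { replace (3 / 2) with (1 + / 2) by lra. rewrite Rpower_plus, Rpower_1, Rpower_sqrt; lra. }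
  rewrite Rpower_mult_distr by lra.
  apply Rle_Rpower_l; [lra|]. split; [|easy]. apply Rmult_lt_0_compat; lra.
Qed.

Lemma passage_bound_nonneg k : 0 <= passage_bound k.
Proof.
  apply Rmult_le_pos; [|left; apply exp_pos].
  destruct k; [simpl; rewrite Rinv_0; lra|]. left. apply Rinv_0_lt_compat, lt_0_INR. lia.
Qed.

Lemma INR_pow2 j : INR (2 ^ j) = 2 ^ j.
Proof. now rewrite pow_INR. Qed.

(** A non-exceptional term is at most 2^(-j) e^(-j) <= 4^(-j), small enough to be
    summed over the 2^j numbers of the block. *)
Lemma passage_bound_block j k : (2 ^ j <= k)%nat ->
  passage_bound k <= (/ 2) ^ j * (/ 2) ^ j +
    (/ 2) ^ j * (if Rlt_dec (sqrt (angle_defect k)) (4 * INR j / 2 ^ j) then 1 else 0).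
Proof.
  intros Hk. unfold passage_bound.
  assert (H2 : 0 < 2 ^ j) by (apply pow_lt; lra).
  assert (HkR : 2 ^ j <= INR k) by (rewrite <- INR_pow2; now apply le_INR).
  assert (Hinv : / INR k <= (/ 2) ^ j) by (rewrite pow_inv; apply Rinv_le_contravar; lra).
  assert (Hinv0 : 0 <= / INR k) by (left; apply Rinv_0_lt_compat; lra).
  assert (Hh : 0 < (/ 2) ^ j) by (apply pow_lt; lra).
  pose proof (sqrt_pos (angle_defect k)) as Hs.
  destruct (Rlt_dec _ _) as [B|B].
  - assert (exp (- (INR k * sqrt (angle_defect k) / 4)) <= 1).
    { rewrite <- exp_0. apply exp_le. nra. }
    pose proof (exp_pos (- (INR k * sqrt (angle_defect k) / 4))). nra.
  - apply Rnot_lt_le in B. rewrite Rmult_0_r, Rplus_0_r.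
    apply Rmult_le_compat; [easy|left; apply exp_pos|easy|].
    apply Rle_trans with (exp (- INR j)).
    + apply exp_le, Ropp_le_contravar.
      apply Rle_trans with (2 ^ j * (4 * INR j / 2 ^ j) / 4); [right; field; lra|].
      apply Rmult_le_compat_r; [lra|]. apply Rmult_le_compat; try lra.
      apply Rdiv_le_0_compat; [pose proof (pos_INR j); lra|easy].
    + rewrite exp_Ropp, pow_inv. apply Rinv_le_contravar; [easy|].
      rewrite exp_INR. apply pow_incr. pose proof (exp_ineq1_le 1). lra.
Qed.

(** By the gaps, the block from 2^j on contains at most 2^j/M + 1 exceptional
    numbers, with M of order j^(3/2), and each of them contributes at most 2^(-j). *)
Theorem ex_series_passage_bound : ex_series (fun k => passage_bound (S k)).
Proof.
  apply -> (ex_series_incr_1 passage_bound).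
  destruct near_period_gap as (c & Hc & Hgap).
  apply (ex_series_dyadic _ (fun j => 2 * (/ 2) ^ j + 2 / c * / (INR j * sqrt (INR j))) 36).
  - apply passage_bound_nonneg.
  - intros j. apply Rplus_le_le_0_compat.
    + apply Rmult_le_pos; [lra|]. apply pow_le. lra.
    + apply Rmult_le_pos; [left; apply Rdiv_lt_0_compat; lra|].
      destruct j; [simpl; rewrite Rmult_0_l, Rinv_0; lra|].
      left. apply Rinv_0_lt_compat, Rmult_lt_0_compat; [|apply sqrt_lt_R0]; apply lt_0_INR; lia.
  - apply (ex_series_plus (K := R_AbsRing) (V := R_NormedModule)).
    + apply (ex_series_scal (K := R_AbsRing) (V := R_NormedModule)). apply ex_series_geom.
      rewrite Rabs_pos_eq; lra.
    + apply (ex_series_scal (K := R_AbsRing) (V := R_NormedModule)). apply ex_series_inv_pow_3_2.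
  - intros j Hj.
    assert (HjR : 36 <= INR j).
    { replace 36 with (INR 36) by (rewrite INR_IZR_INZ; easy). now apply le_INR. }
    assert (Hsj : 0 < sqrt (INR j)) by (apply sqrt_lt_R0; lra).
    set (y := c * (INR j * sqrt (INR j))).
    assert (Hy : 0 < y) by (apply Rmult_lt_0_compat; [easy|]; apply Rmult_lt_0_compat; lra).
    destruct (nfloor_ex y ltac:(lra)) as (N0 & HN1 & HN2).
    (* A natural number below every gap, and still at least y/2. *)
    set (M := Nat.max 1 N0).
    assert (HMy : y / 2 <= INR M).
    { unfold M. destruct (Nat.max_spec 1 N0) as [[Ha ->]|[Ha ->]].
      - assert (1 <= INR N0) by (apply (le_INR 1); lia). lra.
      - assert (INR N0 <= 1) by (apply (le_INR _ 1); lia). simpl (INR 1). lra. }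
    (* Restricting to the block lets the last window overshoot it. *)
    set (P := fun i => andb (Nat.ltb i (2 ^ j))
      (if Rlt_dec (sqrt (angle_defect (2 ^ j + i))) (4 * INR j / 2 ^ j) then true else false)).
    assert (HP : forall i i', (i < i')%nat -> P i = true -> P i' = true -> (M <= i' - i)%nat).
    { intros i i' Hi Pi Pi'. unfold P in Pi, Pi'.
      apply andb_prop in Pi as [_ Pi]. apply andb_prop in Pi' as [_ Pi'].
      destruct (Rlt_dec (sqrt (angle_defect (2 ^ j + i))) _) as [B|]; [|easy].
      destruct (Rlt_dec (sqrt (angle_defect (2 ^ j + i'))) _) as [B'|]; [|easy].
      specialize (Hgap j (2 ^ j + i)%nat (2 ^ j + i')%nat Hj ltac:(lia) B B').
      replace (2 ^ j + i' - (2 ^ j + i))%nat with (i' - i)%nat in Hgap by lia. fold y in Hgap.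
      assert (N0 <= i' - i)%nat by (apply INR_le; lra). unfold M. lia. }
    assert (HM1 : (1 <= M)%nat) by (unfold M; lia).
    pose proof (gap_count P M (2 ^ j / M + 1) HP) as Hcount.
    assert (Hcover : (2 ^ j <= (2 ^ j / M + 1) * M)%nat).
    { pose proof (Nat.div_mod_eq (2 ^ j) M). pose proof (Nat.mod_upper_bound (2 ^ j) M ltac:(lia)). nia. }
    assert (Hind : psum (indicator P) (2 ^ j) <= 2 ^ j / INR M + 1).
    { eapply Rle_trans; [apply psum_mono with (2 := Hcover)|].
      - intros i. unfold indicator. destruct (P i); lra.
      - eapply Rle_trans; [exact Hcount|]. rewrite plus_INR. simpl (INR 1).
        apply Rplus_le_compat_r. assert (0 < INR M) by (apply lt_0_INR; lia).
        apply Rle_div_r; [easy|]. rewrite <- mult_INR, <- INR_pow2. apply le_INR.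
        rewrite Nat.mul_comm. apply Nat.Div0.mul_div_le. }
    assert (H2 : 0 < 2 ^ j) by (apply pow_lt; lra).
    apply Rle_trans with (psum (fun i => (/ 2) ^ j * (/ 2) ^ j + (/ 2) ^ j * indicator P i) (2 ^ j)).
    + apply psum_le. intros i Hi.
      pose proof (passage_bound_block j (2 ^ j + i) ltac:(lia)) as Hb.
      unfold indicator, P. rewrite (proj2 (Nat.ltb_lt _ _) Hi). simpl andb.
      destruct (Rlt_dec _ _); exact Hb.
    + rewrite psum_const_plus_scal, INR_pow2, !pow_inv.
      assert (0 < INR M) by (apply lt_0_INR; lia).
      apply Rle_trans with (2 ^ j * (/ 2 ^ j * / 2 ^ j) + / 2 ^ j * (2 ^ j / INR M + 1)).
      * apply Rplus_le_compat_l, Rmult_le_compat_l; [left; now apply Rinv_0_lt_compat|easy].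
      * replace (2 ^ j * (/ 2 ^ j * / 2 ^ j) + / 2 ^ j * (2 ^ j / INR M + 1))
          with (2 * / 2 ^ j + / INR M) by (field; lra).
        apply Rplus_le_compat_l.
        replace (2 / c * / (INR j * sqrt (INR j))) with (/ (y / 2)) by (unfold y; field; lra).
        apply Rinv_le_contravar; lra.
Qed.

(** * A lazy random walk and its first-passage law *)

(** Law at time n of the walk started at 0, restricted to k >= 0.  By symmetry the state -1
    has the mass of the state 1, whence the coefficient 1/3 in the case k = 0. *)
Fixpoint walk (n k : nat) : R :=
  match n, k with
  | O, O => 1
  | O, S _ => 0
  | S n, O => 2 / 3 * walk n 0 + / 3 * walk n 1
  | S n, S k' => 2 / 3 * walk n (S k') + / 6 * (walk n k' + walk n (S (S k')))
  end.

Lemma walk_S_0 n : walk (S n) 0 = 2 / 3 * walk n 0 + / 3 * walk n 1.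
Proof. easy. Qed.

Lemma walk_S_S n k :
  walk (S n) (S k) = 2 / 3 * walk n (S k) + / 6 * (walk n k + walk n (S (S k))).
Proof. easy. Qed.

Lemma walk_bounds n : forall k, 0 <= walk n k <= 1.
Proof.
  induction n as [|n IH]; intros [|k]; try (simpl; lra).
  - rewrite walk_S_0. pose proof (IH 0%nat). pose proof (IH 1%nat). lra.
  - rewrite walk_S_S. pose proof (IH k). pose proof (IH (S k)). pose proof (IH (S (S k))). lra.
Qed.

Lemma walk_out n : forall k, (n < k)%nat -> walk n k = 0.
Proof.
  induction n as [|n IH]; intros [|k] Hk; try lia; [easy|].
  rewrite walk_S_S, !IH by lia. ring.
Qed.

(** Truncated Fourier series of ((2 + cos x)/3)^n; exact once K >= n. *)
Definition cos_poly (n K : nat) (x : R) : R :=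
  walk n 0 + 2 * psum (fun k => walk n (S k) * cos (INR (S k) * x)) K.

(** Multiplication by (2 + cos x)/3 is one step of the walk, up to the flux through the
    truncation point K. *)
Lemma cos_poly_S n K x :
  cos_poly (S n) K x = (2 + cos x) / 3 * cos_poly n K x +
    / 3 * (walk n (S K) * cos (INR K * x) - walk n K * cos (INR (S K) * x)).
Proof.
  induction K as [|K IH].
  - unfold cos_poly. rewrite walk_S_0. simpl psum. simpl (INR 0). simpl (INR 1).
    rewrite Rmult_0_l, Rmult_1_l, cos_0. field.
  - unfold cos_poly in *. rewrite !psum_S.
    assert (E : cos x * cos (INR (S K) * x) = (cos (INR (S (S K)) * x) + cos (INR K * x)) / 2).
    { rewrite (S_INR (S K)). replace ((INR (S K) + 1) * x) with (INR (S K) * x + x) by ring.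
      replace (INR K * x) with (INR (S K) * x - x) by (rewrite S_INR; ring).
      rewrite cos_plus, cos_minus. field. }
    rewrite !Rmult_plus_distr_l, <- !Rplus_assoc.
    rewrite Rmult_plus_distr_l in IH. rewrite IH, walk_S_S.
    set (p := psum _ K). set (c1 := cos (INR (S K) * x)) in *.
    set (c2 := cos (INR (S (S K)) * x)) in *. set (c0 := cos (INR K * x)) in *.
    assert (E' : (2 + cos x) / 3 * (2 * (walk n (S K) * c1)) =
      4 / 3 * walk n (S K) * c1 + 2 / 3 * walk n (S K) * ((c2 + c0) / 2)) by (rewrite <- E; field).
    rewrite E'. field.
Qed.

Lemma cos_poly_eq n K x : (n <= K)%nat -> cos_poly n K x = ((2 + cos x) / 3) ^ n.
Proof.
  revert K. induction n as [|n IH]; intros K HK.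
  - unfold cos_poly. rewrite psum_zero by (intros; apply Rmult_0_l). simpl. ring.
  - rewrite cos_poly_S, IH, (walk_out n K), (walk_out n (S K)) by lia. simpl pow. ring.
Qed.

Lemma cos_poly_abs_le n K x : Rabs (cos_poly n K x) <= 1 + 2 * INR K.
Proof.
  unfold cos_poly. eapply Rle_trans; [apply Rabs_triang|].
  pose proof (walk_bounds n 0) as H0. rewrite (Rabs_pos_eq (walk n 0)) by lra.
  apply Rplus_le_compat; [lra|].
  rewrite Rabs_mult, (Rabs_pos_eq 2) by lra. apply Rmult_le_compat_l; [lra|].
  induction K as [|K IH]; [simpl; rewrite Rabs_R0; lra|].
  rewrite S_INR, psum_S. eapply Rle_trans; [apply Rabs_triang|].
  apply Rplus_le_compat; [exact IH|].
  rewrite Rabs_mult. pose proof (walk_bounds n (S K)).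
  rewrite (Rabs_pos_eq (walk n (S K))) by lra.
  assert (Rabs (cos (INR (S K) * x)) <= 1) by apply Rabs_le, COS_bound.
  pose proof (Rabs_pos (cos (INR (S K) * x))). nra.
Qed.

(** Fourier coefficients of the derivative of ((2 + cos x)/3)^(n+1).  The proof is an
    induction on n that uses only the one-step rule. *)
Lemma walk_ballot n : forall k,
  INR (S k) * walk (S n) (S k) = INR (S n) / 6 * (walk n k - walk n (S (S k))).
Proof.
  induction n as [|n IH]; intros k.
  - destruct k as [|k]; simpl; field.
  - rewrite walk_S_S.
    assert (H1 : INR (S k) * (walk (S n) k - walk (S n) (S (S k))) +
      2 * walk (S n) (S (S k)) * INR (S k) = INR (S k) * (walk (S n) k + walk (S n) (S (S k)))) by ring.
    pose proof (IH k) as E1. pose proof (IH (S k)) as E2.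
    rewrite (S_INR (S k)) in E2. rewrite (S_INR (S n)).
    destruct k as [|k].
    + simpl (INR 1) in *. rewrite (walk_S_S n 0) in E1 |- *. rewrite (walk_S_S n 1) in E2 |- *.
      rewrite (walk_S_0 n) in *. 
      set (N := INR (S n)) in *. lra.
    + pose proof (IH k) as E0. rewrite (S_INR (S k)) in *.
      rewrite !walk_S_S in *. set (N := INR (S n)) in *. set (q := INR (S k)) in *. lra.
Qed.

(** Probability that the walk reaches k for the first time at time n, by the hitting
    time theorem; what the proof uses is [first_passage_S_S], together with the
    boundary values at n = 0 and at k = 0. *)
Definition first_passage (n k : nat) : R :=
  match n, k with
  | O, O => 1
  | O, S _ => 0
  | S _, O => 0
  | S _, S _ => INR k / INR n * walk n k
  end.

(** The one-step rule with k = 0 made absorbing.  Unlike the walk itself, this has a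
    generating function that is a pure power in k. *)
Lemma first_passage_S_S n k : first_passage (S n) (S k) =
  2 / 3 * first_passage n (S k) + / 6 * (first_passage n k + first_passage n (S (S k))).
Proof.
  destruct n as [|n].
  - simpl. destruct k; simpl; field.
  - assert (Hn : INR (S n) <> 0) by (apply not_0_INR; lia).
    assert (Hn' : INR (S (S n)) <> 0) by (apply not_0_INR; lia).
    assert (E : INR (S n) * (INR (S k) * walk (S (S n)) (S k)) =
      INR (S (S n)) * (INR (S k) * walk (S (S n)) (S k) - / 6 * (walk (S n) k - walk (S n) (S (S k))))).
    { rewrite walk_ballot, (S_INR (S n)). field. }
    apply Rmult_eq_reg_l with (INR (S n) * INR (S (S n))); [|now apply Rmult_integral_contrapositive].
    unfold first_passage at 1 2 4.
    replace (INR (S n) * INR (S (S n)) * (INR (S k) / INR (S (S n)) * walk (S (S n)) (S k)))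
      with (INR (S n) * (INR (S k) * walk (S (S n)) (S k))) by (now field).
    rewrite E, (walk_S_S (S n) k).
    assert (Ek : INR (S n) * first_passage (S n) k = INR k * walk (S n) k).
    { destruct k; [simpl (INR 0); unfold first_passage; ring|]. unfold first_passage. now field. }
    replace (INR (S n) * INR (S (S n)) *
      (2 / 3 * (INR (S k) / INR (S n) * walk (S n) (S k)) +
       / 6 * (first_passage (S n) k + INR (S (S k)) / INR (S n) * walk (S n) (S (S k)))))
      with (INR (S (S n)) * (2 / 3 * (INR (S k) * walk (S n) (S k)) +
       / 6 * (INR (S n) * first_passage (S n) k + INR (S (S k)) * walk (S n) (S (S k))))) by (now field).
    rewrite Ek, (S_INR (S k)), (S_INR k). ring.
Qed.

Lemma first_passage_bounds n k : 0 <= first_passage n k <= 1.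
Proof.
  destruct n as [|n], k as [|k]; try (simpl; lra). unfold first_passage.
  pose proof (walk_bounds (S n) (S k)) as Hw.
  assert (Hn : 0 < INR (S n)) by (apply lt_0_INR; lia).
  pose proof (pos_INR (S k)) as Hk0.
  assert (Hq : 0 <= INR (S k) / INR (S n)) by now apply Rdiv_le_0_compat.
  destruct (Nat.lt_ge_cases (S n) (S k)) as [H|H].
  - rewrite walk_out by easy. lra.
  - assert (INR (S k) / INR (S n) <= 1).
    { apply Rle_div_l; [easy|]. rewrite Rmult_1_l. now apply le_INR. }
    nra.
Qed.

(** * Complex series *)

Notation is_Cseries := (is_series (K := C_AbsRing) (V := C_NormedModule)).
Notation ex_Cseries := (ex_series (K := C_AbsRing) (V := C_NormedModule)).

Lemma is_Cseries_unique a l l' : is_Cseries a l -> is_Cseries a l' -> l = l'.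
Proof. apply filterlim_locally_unique. Qed.

Lemma CSeries_unique a l : is_Cseries a l -> CSeries a = l.
Proof.
  intros H. apply (iota_unique (V := C_CompleteNormedModule)); [|exact H].
  intros y Hy. now apply is_Cseries_unique with a.
Qed.

Lemma is_Cseries_Cscal (c : C) a (l : C) :
  is_Cseries a l -> is_Cseries (fun n => c * a n)%C (c * l)%C.
Proof. exact (is_series_scal (K := C_AbsRing) (V := C_NormedModule) c a l). Qed.

Lemma is_Cseries_Cplus a b (la lb : C) :
  is_Cseries a la -> is_Cseries b lb -> is_Cseries (fun n => a n + b n)%C (la + lb)%C.
Proof. exact (is_series_plus (K := C_AbsRing) (V := C_NormedModule) a b la lb). Qed.

Lemma is_Cseries_ext (a b : nat -> C) (l : C) :
  (forall n, a n = b n) -> is_Cseries a l -> is_Cseries b l.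
Proof. exact (is_series_ext (K := C_AbsRing) (V := C_NormedModule) a b l). Qed.

Lemma is_Cseries_shift (a : nat -> C) (l : C) :
  a 0%nat = RtoC 0 -> is_Cseries (fun n => a (S n)) l -> is_Cseries a l.
Proof.
  intros H0 H. apply (is_series_decr_1 (K := C_AbsRing) (V := C_NormedModule)).
  refine (eq_ind l (fun x : C => is_Cseries (fun n => a (S n)) x) H _ _).
  rewrite H0. change (l = l + - 0)%C. ring.
Qed.

Lemma ex_Cseries_le (a : nat -> C) (b : nat -> R) :
  (forall n, Cmod (a n) <= b n) -> ex_series b -> ex_Cseries a.
Proof.
  intros H Hb. apply (ex_series_le (K := C_AbsRing) (V := C_CompleteNormedModule) a b); [|easy].
  exact H.
Qed.

Lemma is_Cseries_Cmod_le (a : nat -> C) (b : nat -> R) (l : C) (m : R) :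
  (forall n, Cmod (a n) <= b n) -> is_Cseries a l -> is_series b m -> Cmod l <= m.
Proof.
  intros H Ha Hb.
  assert (Hn : is_lim_seq (fun n => Cmod (sum_n (G := C_AbelianMonoid) a n)) (Cmod l)).
  { apply filterlim_comp with (2 := filterlim_norm (K := C_AbsRing) (V := C_NormedModule) l). exact Ha. }
  refine (is_lim_seq_le _ _ (Cmod l) m _ Hn Hb).
  intros n. induction n as [|n IH].
  - rewrite !sum_O. apply H.
  - rewrite !sum_Sn. eapply Rle_trans; [apply Cmod_triangle|]. now apply Rplus_le_compat.
Qed.

Lemma is_Cseries_Re (a : nat -> C) (l : C) :
  is_Cseries a l -> is_series (fun n => Re (a n)) (Re l).
Proof.
  intros H. unfold is_series.
  apply filterlim_ext with (fun n => fst (sum_n (G := C_AbelianMonoid) a n)).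
  - induction x as [|n IH].
    + now rewrite !sum_O.
    + rewrite !sum_Sn, <- IH. reflexivity.
  - eapply filterlim_comp; [exact H|].
    apply filterlim_locally. intros eps. 
    exists eps. intros y Hy. exact (proj1 Hy).
Qed.

(** * The generating function of first passage *)

Definition passage_term (k : nat) (z : C) (n : nat) : C := (RtoC (first_passage n k) * Cpow z n)%C.

Lemma Cmod_passage_term_le k z n : Cmod (passage_term k z n) <= Cmod z ^ n.
Proof.
  unfold passage_term. rewrite Cmod_mult, Cmod_R, Cmod_pow.
  pose proof (first_passage_bounds n k). rewrite Rabs_pos_eq by lra.
  assert (0 <= Cmod z ^ n) by apply pow_le, Cmod_ge_0. nra.
Qed.

Lemma is_series_geom_Cmod z : Cmod z < 1 -> is_series (fun n => Cmod z ^ n) (/ (1 - Cmod z)).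
Proof. intros H. apply is_series_geom. rewrite Rabs_pos_eq; [easy|apply Cmod_ge_0]. Qed.

Lemma passage_gen_correct k z : Cmod z < 1 -> is_Cseries (passage_term k z) (CSeries (passage_term k z)).
Proof.
  intros H. destruct (ex_Cseries_le (passage_term k z) _ (Cmod_passage_term_le k z)) as [l Hl].
  - eexists. now apply is_series_geom_Cmod.
  - now rewrite (CSeries_unique _ _ Hl).
Qed.

Lemma passage_gen_Cmod_le k z : Cmod z < 1 -> Cmod (CSeries (passage_term k z)) <= / (1 - Cmod z).
Proof.
  intros H. exact (is_Cseries_Cmod_le _ _ _ _ (Cmod_passage_term_le k z)
    (passage_gen_correct k z H) (is_series_geom_Cmod z H)).
Qed.

Lemma is_Cseries_first_term (a : nat -> C) :
  (forall n, a (S n) = RtoC 0) -> is_Cseries a (a 0%nat).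
Proof.
  intros H. apply filterlim_ext with (fun _ : nat => a 0%nat); [|apply filterlim_const].
  intros n. induction n as [|n IH]; [now rewrite sum_O|].
  rewrite sum_Sn, <- IH, H. change (a 0%nat = a 0%nat + RtoC 0)%C. ring.
Qed.

Lemma passage_gen_0 z : CSeries (passage_term 0 z) = RtoC 1.
Proof.
  apply CSeries_unique.
  replace (RtoC 1) with (passage_term 0 z 0) by (unfold passage_term; simpl; ring).
  apply is_Cseries_first_term. intros n. unfold passage_term. simpl first_passage. ring.
Qed.

Lemma passage_gen_rec k z : Cmod z < 1 ->
  CSeries (passage_term (S k) z) =
  (z * (RtoC (2 / 3) * CSeries (passage_term (S k) z) +
        RtoC (/ 6) * (CSeries (passage_term k z) + CSeries (passage_term (S (S k)) z))))%C.
Proof.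
  intros Hz. apply CSeries_unique.
  apply is_Cseries_shift; [unfold passage_term; simpl first_passage; ring|].
  pose proof (passage_gen_correct k z Hz) as H0. pose proof (passage_gen_correct (S k) z Hz) as H1.
  pose proof (passage_gen_correct (S (S k)) z Hz) as H2.
  pose proof (is_Cseries_Cscal z _ _ (is_Cseries_Cplus _ _ _ _
    (is_Cseries_Cscal (RtoC (2 / 3)) _ _ H1)
    (is_Cseries_Cscal (RtoC (/ 6)) _ _ (is_Cseries_Cplus _ _ _ _ H0 H2)))) as H.
  revert H. apply is_Cseries_ext. intros n. unfold passage_term.
  rewrite first_passage_S_S. simpl Cpow. rewrite RtoC_plus, !RtoC_mult, RtoC_plus. ring.
Qed.

(** A quantity that survives arbitrarily many contractions is not positive. *)
Lemma geom_bounded_0 (x q M : R) : 0 <= q < 1 -> (forall n, x <= q ^ n * M) -> x <= 0.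
Proof.
  intros Hq Hx.
  assert (Hl : is_lim_seq (fun n => q ^ n * M) (0 * M)).
  { apply is_lim_seq_mult'; [|apply is_lim_seq_const].
    apply is_lim_seq_geom. rewrite Rabs_pos_eq; lra. }
  rewrite Rmult_0_l in Hl.
  exact (is_lim_seq_le (fun _ => x) _ x 0 Hx (is_lim_seq_const x) Hl).
Qed.

(** The generating functions satisfy a recurrence of order two in k, with characteristic
    roots u and 1/u, and they are bounded in k.  So the component along 1/u, isolated by
    F(k+1) - u F(k), must vanish. *)
Lemma passage_gen_eq z u k : z <> RtoC 0 -> Cmod z < 1 -> Cmod u < 1 ->
  (u * u + RtoC 1 = (RtoC 6 / z - RtoC 4) * u)%C ->
  CSeries (passage_term k z) = Cpow u k.
Proof.
  intros Hz0 Hz Hu Eu.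
  set (F := fun k => CSeries (passage_term k z)).
  assert (Hrec : forall k, F (S (S k)) = ((RtoC 6 / z - RtoC 4) * F (S k) - F k)%C).
  { intros j. pose proof (passage_gen_rec j z Hz) as H. fold (F j) (F (S j)) (F (S (S j))) in H.
    assert (H6 : (RtoC 6 / z * F (S j) = RtoC 4 * F (S j) + (F j + F (S (S j))))%C).
    { rewrite H at 1. replace (RtoC (2 / 3)) with (RtoC 4 / RtoC 6)%C.
      - rewrite RtoC_inv by lra. field. easy.
      - rewrite <- RtoC_div by lra. f_equal. lra. }
    replace ((RtoC 6 / z - RtoC 4) * F (S j) - F j)%C
      with (RtoC 6 / z * F (S j) - RtoC 4 * F (S j) - F j)%C by ring.
    rewrite H6. ring. }
  set (D := fun k => (F (S k) - u * F k)%C).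
  assert (HD : forall k, D k = (u * D (S k))%C).
  { intros j. unfold D. rewrite Hrec.
    replace (u * ((RtoC 6 / z - RtoC 4) * F (S j) - F j - u * F (S j)))%C
      with ((RtoC 6 / z - RtoC 4) * u * F (S j) - u * F j - u * u * F (S j))%C by ring.
    rewrite <- Eu. ring. }
  assert (HDn : forall n k, Cmod (D k) = Cmod u ^ n * Cmod (D (n + k)%nat)).
  { induction n as [|n IH]; intros j; [simpl; ring|].
    rewrite IH, HD, Cmod_mult. simpl. ring. }
  assert (HD0 : forall k, D k = RtoC 0).
  { intros j. apply Cmod_eq_0. apply Rle_antisym; [|apply Cmod_ge_0].
    apply geom_bounded_0 with (Cmod u) (/ (1 - Cmod z) + / (1 - Cmod z)).
    - split; [apply Cmod_ge_0|easy].
    - intros n. rewrite (HDn n). apply Rmult_le_compat_l; [apply pow_le, Cmod_ge_0|].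
      unfold D, Cminus. eapply Rle_trans; [apply Cmod_triangle|].
      pose proof (passage_gen_Cmod_le (S (n + j)) z Hz). pose proof (passage_gen_Cmod_le (n + j) z Hz).
      apply Rplus_le_compat; [easy|]. rewrite Cmod_opp, Cmod_mult. unfold F.
      pose proof (Cmod_ge_0 u). pose proof (Cmod_ge_0 (CSeries (passage_term (n + j) z))). nra. }
  change (F k = Cpow u k). induction k as [|k IH].
  - apply passage_gen_0.
  - specialize (HD0 k). unfold D in HD0.
    simpl Cpow. rewrite <- IH.
    replace (F (S k)) with (F (S k) - u * F k + u * F k)%C by ring. rewrite HD0. ring.
Qed.

Lemma Csqrt_ex (w : C) : exists v : C, (v * v = w)%C.
Proof.
  destruct w as [x y]. set (M := Cmod (x, y)).
  assert (HM : M * M = x * x + y * y).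
  { unfold M, Cmod. simpl fst. simpl snd. rewrite sqrt_sqrt by nra. ring. }
  assert (HM0 : 0 <= M) by apply Cmod_ge_0.
  assert (Hx : - M <= x <= M).
  { apply Rabs_le_between. unfold M. exact (re_le_Cmod (x, y)). }
  set (p := sqrt ((M + x) / 2)). set (q := sqrt ((M - x) / 2)).
  assert (Ep : p * p = (M + x) / 2) by (apply sqrt_sqrt; lra).
  assert (Eq : q * q = (M - x) / 2) by (apply sqrt_sqrt; lra).
  assert (Epq : 2 * (p * q) = Rabs y).
  { unfold p, q. rewrite <- sqrt_mult by lra.
    replace ((M + x) / 2 * ((M - x) / 2)) with (Rsqr (y / 2)) by (unfold Rsqr; nra).
    rewrite sqrt_Rsqr_abs. unfold Rdiv. rewrite Rabs_mult, (Rabs_pos_eq (/ 2)); lra. }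
  destruct (Rle_dec 0 y) as [Hy|Hy].
  - exists (p, q). rewrite Rabs_pos_eq in Epq by easy.
    unfold Cmult. simpl. f_equal; lra.
  - exists (p, - q). rewrite Rabs_left in Epq by lra.
    unfold Cmult. simpl. f_equal; lra.
Qed.

Lemma Cmod_parallelogram (u : C) :
  Cmod (u - RtoC 1) ^ 2 + Cmod (u + RtoC 1) ^ 2 = 2 * (Cmod u ^ 2 + 1).
Proof.
  rewrite !Cmod2_alt. destruct u as [x y]. simpl. ring.
Qed.

(** The product of the two roots is 1.  The last inequality is the identity
    2(|u| + 1/|u|) = |s - 2| + |s + 2| for s = u + 1/u, that is the parallelogram law
    applied to u and 1, together with |s + 2| >= 4 for s = 6/z - 4. *)
Lemma small_root z : z <> RtoC 0 -> Cmod z < 1 ->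
  exists u : C, Cmod u < 1 /\ (u * u + RtoC 1 = (RtoC 6 / z - RtoC 4) * u)%C /\
    3 * Cmod u * Cmod (/ z - RtoC 1) <= (1 - Cmod u) ^ 2.
Proof.
  intros Hz0 Hz. set (s := (RtoC 6 / z - RtoC 4)%C).
  assert (Hz1 : 0 < Cmod z) by now apply Cmod_gt_0.
  assert (H1 : exists u v : C, (u * v = RtoC 1 /\ u * u + RtoC 1 = s * u /\ v * v + RtoC 1 = s * v)%C).
  { destruct (Csqrt_ex (s * s - RtoC 4)%C) as [w Hw].
    assert (E2 : (RtoC 2 <> RtoC 0)%C) by (intros E; apply RtoC_inj in E; lra).
    assert (E4 : (RtoC 4 = RtoC 2 * RtoC 2)%C) by (rewrite <- RtoC_mult; f_equal; lra).
    rewrite E4 in Hw.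
    exists ((s + w) / RtoC 2)%C, ((s - w) / RtoC 2)%C. repeat split.
    - replace ((s + w) / RtoC 2 * ((s - w) / RtoC 2))%C with ((s * s - w * w) / (RtoC 2 * RtoC 2))%C by (field; auto).
      rewrite Hw. field; auto.
    - replace ((s + w) / RtoC 2 * ((s + w) / RtoC 2))%C with ((s * s + RtoC 2 * s * w + w * w) / (RtoC 2 * RtoC 2))%C by (field; auto).
      rewrite Hw. field; auto.
    - replace ((s - w) / RtoC 2 * ((s - w) / RtoC 2))%C with ((s * s - RtoC 2 * s * w + w * w) / (RtoC 2 * RtoC 2))%C by (field; auto).
      rewrite Hw. field; auto. }
  assert (H2 : exists u : C, 0 < Cmod u <= 1 /\ (u * u + RtoC 1 = s * u)%C).
  { destruct H1 as (u & v & E & Eu & Ev).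
    assert (Em : Cmod u * Cmod v = 1) by (rewrite <- Cmod_mult, E; apply Cmod_1).
    pose proof (Cmod_ge_0 u). pose proof (Cmod_ge_0 v).
    destruct (Rle_dec (Cmod u) 1) as [Hu|Hu].
    - exists u. split; [|easy]. split; [|easy]. nra.
    - exists v. split; [|easy]. split; nra. }
  destruct H2 as (u & [Hu0 Hu1] & Eu). clear H1.
  assert (Hineq : 3 * Cmod u * Cmod (/ z - RtoC 1) <= (1 - Cmod u) ^ 2).
  { assert (Em : Cmod (u - RtoC 1) ^ 2 = Cmod u * (6 * Cmod (/ z - RtoC 1))).
    { rewrite <- Cmod_pow.
      replace ((u - RtoC 1) ^ 2)%C with (u * (RtoC 6 * (/ z - RtoC 1)))%C.
      - rewrite !Cmod_mult, Cmod_R, Rabs_pos_eq; lra.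
      - replace ((u - RtoC 1) ^ 2)%C with (u * u + RtoC 1 - RtoC 2 * u)%C by (simpl; ring).
        rewrite Eu. unfold s.
        replace (RtoC 6) with (RtoC 4 + RtoC 2)%C at 1 2 by (rewrite <- RtoC_plus; f_equal; lra).
        field. easy. }
    assert (Ep : Cmod (u + RtoC 1) ^ 2 = Cmod u * Cmod (RtoC 6 / z - RtoC 2)).
    { rewrite <- Cmod_pow, <- Cmod_mult. f_equal.
      replace ((u + RtoC 1) ^ 2)%C with (u * u + RtoC 1 + RtoC 2 * u)%C by (simpl; ring).
      rewrite Eu. unfold s.
      replace (RtoC 4) with (RtoC 2 + RtoC 2)%C by (rewrite <- RtoC_plus; f_equal; lra). ring. }
    assert (H4 : 4 <= Cmod (RtoC 6 / z - RtoC 2)).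
    { pose proof (Cmod_triangle (RtoC 6 / z - RtoC 2) (RtoC 2)) as Ht.
      replace (RtoC 6 / z - RtoC 2 + RtoC 2)%C with (RtoC 6 / z)%C in Ht by ring.
      rewrite Cmod_div in Ht by easy. rewrite !Cmod_R, (Rabs_pos_eq 6), (Rabs_pos_eq 2) in Ht by lra.
      assert (6 <= 6 / Cmod z) by (apply (Rle_div_r 6 6 (Cmod z)); lra). lra. }
    pose proof (Cmod_parallelogram u) as Hpar. rewrite Em, Ep in Hpar. nra. }
  exists u. split; [|split; [easy|easy]].
  destruct (Rlt_dec (Cmod u) 1) as [Hlt|Hge]; [easy|]. exfalso.
  assert (E1 : Cmod u = 1) by lra. rewrite E1 in Hineq.
  assert (E0 : Cmod (/ z - RtoC 1) = 0).
  { pose proof (Cmod_ge_0 (/ z - RtoC 1)%C). simpl in Hineq. lra. }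
  apply Cmod_eq_0 in E0.
  assert (Hinv : (/ z = RtoC 1)%C).
  { replace (/ z)%C with (/ z - RtoC 1 + RtoC 1)%C by ring. rewrite E0. ring. }
  assert (Cmod (/ z) = 1) by (rewrite Hinv; apply Cmod_1).
  rewrite Cmod_inv in H by easy. assert (1 < / Cmod z); [|lra].
  rewrite <- Rinv_1. apply Rinv_lt_contravar; lra.
Qed.

Lemma expi_mod t : Cmod (expi t) = 1.
Proof.
  transitivity (sqrt 1); [|apply sqrt_1]. unfold Cmod, expi. simpl. f_equal.
  pose proof (sin2_cos2 t) as H. unfold Rsqr in H. lra.
Qed.

Lemma expi_plus s t : expi (s + t) = (expi s * expi t)%C.
Proof. unfold expi, Cmult. simpl. rewrite cos_plus, sin_plus. f_equal; ring. Qed.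

Lemma expi_pow t n : Cpow (expi t) n = expi (INR n * t).
Proof.
  induction n as [|n IH].
  - simpl. rewrite Rmult_0_l. unfold expi. now rewrite cos_0, sin_0.
  - simpl Cpow. rewrite IH, <- expi_plus. f_equal. rewrite S_INR. ring.
Qed.

Lemma Re_RtoC_expi a t : Re (RtoC a * expi t) = a * cos t.
Proof. unfold expi, RtoC, Cmult. simpl. ring. Qed.

Lemma inv_sub_1_ge r t : 0 < r < 1 ->
  2 * Rabs (sin (t / 2)) <= Cmod (/ (RtoC r * expi t) - RtoC 1).
Proof.
  intros Hr. set (z := (RtoC r * expi t)%C).
  assert (Hm : Cmod z = r).
  { unfold z. rewrite Cmod_mult, Cmod_R, expi_mod, Rabs_pos_eq; lra. }
  assert (Hz : z <> RtoC 0) by (apply Cmod_gt_0; lra).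
  replace (/ z - RtoC 1)%C with ((RtoC 1 - z) / z)%C by (field; easy).
  rewrite Cmod_div, Hm by easy.
  apply (Rle_div_r _ _ r); [lra|].
  apply Rsqr_incr_0_var; [|apply Cmod_ge_0].
  assert (Ec : cos t = 1 - 2 * (sin (t / 2) * sin (t / 2))).
  { replace t with (2 * (t / 2)) at 1 by lra. rewrite cos_2a_sin. ring. }
  assert (Es : sin t * sin t = 1 - cos t * cos t).
  { pose proof (sin2_cos2 t) as H. unfold Rsqr in H. lra. }
  assert (Ez : Cmod (RtoC 1 - z) ^ 2 = (1 - r) ^ 2 + 4 * r * (sin (t / 2) * sin (t / 2))).
  { rewrite Cmod2_alt. unfold z, expi. simpl.
    replace (1 + - (r * cos t - 0 * sin t)) with (1 - r * cos t) by ring.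
    replace (0 + - (r * sin t + 0 * cos t)) with (- (r * sin t)) by ring.
    replace ((1 - r * cos t) * ((1 - r * cos t) * 1) + - (r * sin t) * (- (r * sin t) * 1))
      with ((1 - r * cos t) * (1 - r * cos t) + r * r * (sin t * sin t)) by ring.
    rewrite Es, Ec. ring. }
  rewrite (Rsqr_pow2 (Cmod _)), Ez.
  replace (Rsqr (2 * Rabs (sin (t / 2)) * r))
    with (4 * r * r * (Rabs (sin (t / 2)) * Rabs (sin (t / 2)))) by (unfold Rsqr; ring).
  rewrite <- Rabs_mult, (Rabs_pos_eq (sin _ * sin _)) by nra.
  assert (Hp : 0 <= sin (t / 2) * sin (t / 2)) by nra.
  assert (0 <= r * (1 - r) * (sin (t / 2) * sin (t / 2))) by (apply Rmult_le_pos; nra).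
  assert (0 <= (1 - r) ^ 2) by apply pow2_ge_0. lra.
Qed.

(** If rho > 1/2 the hypothesis gives 1 - rho >= sqrt e; smaller rho are below the
    minimum 3/4 of 1 - sqrt e/4. *)
Lemma root_le_exp (rho e : R) : 0 <= rho <= 1 -> 0 <= e <= 1 ->
  6 * rho * e <= (1 - rho) ^ 2 -> rho <= exp (- (sqrt e / 4)).
Proof.
  intros Hr He H.
  assert (Hs0 : 0 <= sqrt e) by apply sqrt_pos.
  assert (Hs : sqrt e * sqrt e = e) by (apply sqrt_sqrt; lra).
  assert (Hs1 : sqrt e <= 1) by nra.
  apply Rle_trans with (1 + - (sqrt e / 4)); [|apply exp_ineq1_le].
  destruct (Rle_dec rho (/ 2)) as [Hle|Hgt]; [lra|].
  assert (sqrt e <= 1 - rho); [|lra].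
  apply Rsqr_incr_0_var; [|lra]. unfold Rsqr. nra.
Qed.

(** The square root in the exponent reflects the branch point of u at z = 1.  What matters
    is that the bound does not depend on r. *)
Lemma passage_gen_bound k r t : 0 < r < 1 ->
  Cmod (CSeries (passage_term k (RtoC r * expi t))) <= exp (- (INR k * sqrt (Rabs (sin (t / 2))) / 4)).
Proof.
  intros Hr. set (z := (RtoC r * expi t)%C).
  assert (Hm : Cmod z = r).
  { unfold z. rewrite Cmod_mult, Cmod_R, expi_mod, Rabs_pos_eq; lra. }
  assert (Hz : z <> RtoC 0) by (apply Cmod_gt_0; lra).
  destruct (small_root z Hz ltac:(lra)) as (u & Hu & Eu & Hineq).
  rewrite (passage_gen_eq z u k Hz ltac:(lra) Hu Eu), Cmod_pow.
  pose proof (inv_sub_1_ge r t Hr) as Hge. fold z in Hge.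
  pose proof (Cmod_ge_0 u) as Hu0.
  set (e := Rabs (sin (t / 2))) in *.
  assert (He : 0 <= e <= 1).
  { split; [apply Rabs_pos|]. apply Rabs_le, SIN_bound. }
  assert (Hrho : Cmod u <= exp (- (sqrt e / 4))) by (apply root_le_exp; try lra; nra).
  replace (exp (- (INR k * sqrt e / 4))) with (exp (- (sqrt e / 4)) ^ k).
  - apply pow_incr. lra.
  - rewrite <- exp_INR_mult. f_equal. field.
Qed.

Lemma passage_gen_real r : 0 < r < 1 -> exists u : R, 0 < u < 1 /\
  (1 - u) ^ 2 = 6 * u * (1 - r) / r /\
  forall k, is_series (fun n => first_passage n k * r ^ n) (u ^ k).
Proof.
  intros Hr. set (s := 6 / r - 4).
  assert (Hs : 2 < s).
  { unfold s. assert (6 < 6 / r); [|lra]. apply (Rlt_div_r 6 6 r); lra. }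
  set (w := sqrt (s * s - 4)).
  assert (Hw : w * w = s * s - 4) by (apply sqrt_sqrt; nra).
  assert (Hw0 : 0 <= w) by apply sqrt_pos.
  exists ((s - w) / 2). set (u := (s - w) / 2).
  assert (Hws : w < s) by nra.
  assert (Hu0 : 0 < u) by (unfold u; lra).
  assert (Hu1 : u < 1).
  { unfold u. assert (s - 2 < w); [|lra]. nra. }
  assert (Eu : u * u + 1 = s * u) by (unfold u; nra).
  split; [lra|]. split.
  { replace ((1 - u) ^ 2) with (u * u + 1 - 2 * u) by ring. rewrite Eu. unfold s. field. lra. }
  intros k.
  assert (Hm : Cmod (RtoC r) < 1) by (rewrite Cmod_R, Rabs_pos_eq; lra).
  assert (HF : CSeries (passage_term k (RtoC r)) = Cpow (RtoC u) k).
  { apply passage_gen_eq; [intros E; apply RtoC_inj in E; lra|easy| |].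
    - rewrite Cmod_R, Rabs_pos_eq; lra.
    - rewrite <- RtoC_div, <- RtoC_minus, <- !RtoC_mult, <- RtoC_plus by lra. f_equal. exact Eu. }
  pose proof (is_Cseries_Re _ _ (passage_gen_correct k _ Hm)) as H. rewrite HF, <- RtoC_pow in H.
  change (Re (RtoC (u ^ k))) with (u ^ k) in H. revert H. apply is_series_Rext. intros n.
  unfold passage_term. rewrite <- RtoC_pow, <- RtoC_mult. easy.
Qed.

(** * Limits of series *)

Lemma is_series_skip (a : nat -> R) (l : R) (N : nat) :
  is_series a l -> is_series (fun i => a (N + i)%nat) (l - psum a N).
Proof.
  intros H. induction N as [|N IH].
  - rewrite Rminus_0_r. exact H.
  - apply is_series_tail in IH. rewrite Nat.add_0_r in IH.
    rewrite psum_S. replace (l - (psum a N + a N)) with (l - psum a N - a N) by ring.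
    revert IH. apply is_series_Rext. intros n. f_equal. lia.
Qed.

Lemma Series_tail_le (a h : nat -> R) (N : nat) :
  (forall n, Rabs (a n) <= h n) -> ex_series h ->
  Rabs (Series a - psum a N) <= Series h - psum h N.
Proof.
  intros H Hh.
  assert (Ha : ex_series a) by now apply (ex_series_le (K := R_AbsRing) (V := R_CompleteNormedModule)) with h.
  refine (is_series_Rabs_le _ _ _ _ _ (is_series_skip _ _ N (Series_correct _ Ha))
    (is_series_skip _ _ N (Series_correct _ Hh))).
  intros n. apply H.
Qed.

Lemma is_series_geom_error (a : nat -> R) (L B q : R) :
  0 <= q < 1 -> (forall N, Rabs (L - psum a N) <= B * q ^ N) -> is_series a L.
Proof.
  intros Hq H.
  assert (Hl : is_lim_seq (psum a) L).
  { apply is_lim_seq_ext with (fun n => L - (L - psum a n)); [intros; ring|].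
    replace L with (L - 0) at 1 by ring.
    apply is_lim_seq_minus'; [apply is_lim_seq_const|].
    apply is_lim_seq_abs_0.
    apply is_lim_seq_le_le with (fun _ => 0) (fun n => B * q ^ n).
    - intros n. split; [apply Rabs_pos|apply H].
    - apply is_lim_seq_const.
    - replace (Finite 0) with (Finite (B * 0)) by (f_equal; ring).
      apply is_lim_seq_mult'; [apply is_lim_seq_const|].
      apply is_lim_seq_geom. rewrite Rabs_pos_eq; lra. }
  apply is_lim_seq_incr_1 in Hl. revert Hl. apply filterlim_ext.
  intros n. now rewrite sum_n_psum.
Qed.

Lemma is_lim_seq_psum (a : nat -> nat -> R) (b : nat -> R) (N : nat) :
  (forall n, is_lim_seq (fun i => a i n) (b n)) ->
  is_lim_seq (fun i => psum (a i) N) (psum b N).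
Proof.
  intros H. induction N as [|N IH]; [apply is_lim_seq_const|].
  now apply is_lim_seq_plus'.
Qed.

Lemma is_lim_seq_Rabs_le (a : nat -> R) (l M : R) :
  (forall i, Rabs (a i) <= M) -> is_lim_seq a l -> Rabs l <= M.
Proof.
  intros H Hl. apply is_lim_seq_abs in Hl.
  exact (is_lim_seq_le _ (fun _ => M) (Rabs l) M H Hl (is_lim_seq_const M)).
Qed.

(** Dominated convergence for series: cut at N where the tail of h is negligible. *)
Lemma tannery (a : nat -> nat -> R) (b h : nat -> R) :
  (forall i n, Rabs (a i n) <= h n) -> ex_series h ->
  (forall n, is_lim_seq (fun i => a i n) (b n)) ->
  is_lim_seq (fun i => Series (a i)) (Series b).
Proof.
  intros Ha Hh Hb.
  assert (Hbh : forall n, Rabs (b n) <= h n).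
  { intros n. apply is_lim_seq_Rabs_le with (2 := Hb n). intros i. apply Ha. }
  apply is_lim_seq_spec. intros eps.
  assert (He : 0 < eps / 4) by (pose proof (cond_pos eps); lra).
  assert (Hsum : is_lim_seq (sum_n h) (Series h)) by exact (Series_correct _ Hh).
  apply is_lim_seq_spec in Hsum. destruct (Hsum (mkposreal _ He)) as [N HN].
  specialize (HN N (le_n N)). cbn [pos] in HN. rewrite sum_n_psum in HN.
  apply Rabs_lt_between in HN.
  pose proof (is_lim_seq_psum a b (S N) Hb) as Hfin.
  apply is_lim_seq_spec in Hfin. destruct (Hfin (mkposreal _ He)) as [I HI].
  exists I. intros i Hi. specialize (HI i Hi). cbn [pos] in HI.
  pose proof (Series_tail_le (a i) h (S N) (Ha i) Hh) as H1.
  pose proof (Series_tail_le b h (S N) Hbh Hh) as H2.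
  apply Rabs_le_between in H1. apply Rabs_le_between in H2. apply Rabs_lt_between in HI.
  apply Rabs_lt_between. lra.
Qed.

(** * Abel means *)

(** A sequence of radii tending to 1, along which Abel means are taken. *)
Definition abel_radius (i : nat) : R := 1 - / (INR i + 2).

Lemma abel_radius_bounds i : / 2 <= abel_radius i < 1.
Proof.
  unfold abel_radius. pose proof (pos_INR i).
  assert (0 < / (INR i + 2)) by (apply Rinv_0_lt_compat; lra).
  assert (/ (INR i + 2) <= / 2) by (apply Rinv_le_contravar; lra). lra.
Qed.

Lemma abel_radius_lim : is_lim_seq abel_radius 1.
Proof.
  unfold abel_radius. replace (Finite 1) with (Finite (1 - 0)) by (f_equal; ring).
  apply is_lim_seq_minus'; [apply is_lim_seq_const|].
  apply (is_lim_seq_inv _ p_infty); [|easy].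
  apply is_lim_seq_plus with p_infty 2; [apply is_lim_seq_INR|apply is_lim_seq_const|easy].
Qed.

Lemma abel_radius_pow_lim n c : is_lim_seq (fun i => abel_radius i ^ n * c) c.
Proof.
  replace (Finite c) with (Finite (1 * c)) by (f_equal; ring).
  apply is_lim_seq_mult'; [|apply is_lim_seq_const].
  induction n as [|n IH]; [apply is_lim_seq_const|].
  replace (Finite 1) with (Finite (1 * 1)) by (f_equal; ring).
  now apply is_lim_seq_mult'; [apply abel_radius_lim|].
Qed.

Lemma abel_radius_pow_bounds i n : 0 <= abel_radius i ^ n <= 1.
Proof.
  pose proof (abel_radius_bounds i). split; [apply pow_le; lra|].
  rewrite <- (pow1 n). apply pow_incr. lra.
Qed.

(** For non-negative terms, bounded Abel means bound the partial sums. *)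
Lemma ex_series_abel (a : nat -> R) (M : R) :
  (forall n, 0 <= a n) ->
  (forall i, exists l, is_series (fun n => abel_radius i ^ S n * a n) l /\ l <= M) ->
  ex_series a.
Proof.
  intros Ha H. apply ex_series_psum_bounded with M; [easy|]. intros N.
  refine (is_lim_seq_le (fun i => psum (fun n => abel_radius i ^ S n * a n) N) (fun _ => M) (psum a N) M _ _ (is_lim_seq_const M)).
  - intros i. destruct (H i) as (l & Hl & HlM).
    apply Rle_trans with l; [|easy]. rewrite <- (is_series_unique _ _ Hl).
    apply psum_le_Series; [|now exists l].
    intros n. apply Rmult_le_pos; [apply abel_radius_pow_bounds|apply Ha].
  - apply is_lim_seq_psum. intros n. apply abel_radius_pow_lim.
Qed.

Lemma abel_lim (a : nat -> R) : ex_series (fun n => Rabs (a n)) ->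
  is_lim_seq (fun i => Series (fun n => abel_radius i ^ S n * a n)) (Series a).
Proof.
  intros Ha. apply (tannery (fun i n => abel_radius i ^ S n * a n) a (fun n => Rabs (a n))); [|easy|].
  - intros i n. rewrite Rabs_mult. pose proof (abel_radius_pow_bounds i (S n)).
    rewrite (Rabs_pos_eq (abel_radius i ^ S n)) by lra. pose proof (Rabs_pos (a n)). nra.
  - intros n. apply abel_radius_pow_lim.
Qed.

Lemma psum_pow y N : y <> 1 -> psum (fun m => y ^ m) N = (1 - y ^ N) / (1 - y).
Proof.
  intros Hy. induction N as [|N IH]; [simpl; field; lra|].
  rewrite psum_S, IH, <- tech_pow_Rmult. field. lra.
Qed.

Lemma is_derive_psum_pow y N :
  is_derive (fun y => psum (fun m => y ^ S m / INR (S m)) N) y (psum (fun m => y ^ m) N).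
Proof.
  induction N as [|N IH];
    [exact (is_derive_const (K := R_AbsRing) (V := R_NormedModule) 0 y)|].
  apply (is_derive_plus (K := R_AbsRing) (V := R_NormedModule)
    (fun y => psum (fun m => y ^ S m / INR (S m)) N) (fun y => y ^ S N / INR (S N))); [exact IH|].
  assert (INR (S N) <> 0) by (apply not_0_INR; lia).
  auto_derive; [easy|]. change (1 * (INR (S N) * y ^ N) * / INR (S N) = y ^ N).
  field. easy.
Qed.

(** The remainder of order N has derivative y^N/(1 - y), which the mean value theorem
    turns into a geometric error. *)
Lemma is_series_ln x : 0 <= x < 1 ->
  is_series (fun m => x ^ S m / INR (S m)) (- ln (1 - x)).
Proof.
  intros Hx. apply is_series_geom_error with (/ (1 - x)) x; [easy|]. intros N.
  destruct (MVT_gen (fun y => - ln (1 - y) - psum (fun m => y ^ S m / INR (S m)) N) 0 x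
    (fun y => / (1 - y) - psum (fun m => y ^ m) N)) as (c & Hc & E).
  - intros y Hy. rewrite Rmin_left, Rmax_right in Hy by lra.
    apply (is_derive_minus (K := R_AbsRing) (V := R_NormedModule)
      (fun y => - ln (1 - y)) (fun y => psum (fun m => y ^ S m / INR (S m)) N)); [|apply is_derive_psum_pow].
    auto_derive; [lra|field; lra].
  - intros y Hy. rewrite Rmin_left, Rmax_right in Hy by lra.
    apply continuity_pt_filterlim.
    apply (ex_derive_continuous (fun y => - ln (1 - y) - psum (fun m => y ^ S m / INR (S m)) N)).
    eexists. apply (is_derive_minus (K := R_AbsRing) (V := R_NormedModule)
      (fun y => - ln (1 - y)) (fun y => psum (fun m => y ^ S m / INR (S m)) N)); [|apply is_derive_psum_pow].
    auto_derive; [lra|reflexivity].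
  - rewrite Rmin_left, Rmax_right in Hc by lra.
    rewrite (psum_zero (fun m => 0 ^ S m / INR (S m))) in E
      by (intros i _; rewrite pow_i by lia; unfold Rdiv; ring).
    rewrite !Rminus_0_r, ln_1, Ropp_0, Rminus_0_r in E. rewrite E.
    rewrite psum_pow by lra.
    replace (/ (1 - c) - (1 - c ^ N) / (1 - c)) with (c ^ N * / (1 - c)) by (field; lra).
    assert (0 <= c ^ N <= x ^ N) by (split; [apply pow_le|apply pow_incr]; lra).
    assert (0 < / (1 - c)) by (apply Rinv_0_lt_compat; lra).
    assert (/ (1 - c) <= / (1 - x)) by (apply Rinv_le_contravar; lra).
    assert (0 <= c ^ N * / (1 - c)) by nra.
    rewrite Rabs_pos_eq by nra.
    apply Rle_trans with (c ^ N * / (1 - c)); [nra|].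
    rewrite Rmult_comm. apply Rmult_le_compat; lra.
Qed.

(** * Interchange of the sums *)

Definition walk_term (x : nat -> R) (k m : nat) : R :=
  / INR (S m) * walk (S m) k * cos (INR k * x (S m)).

Lemma inv_INR_S m : 0 < / INR (S m) <= 1.
Proof.
  split; [apply Rinv_0_lt_compat, lt_0_INR; lia|].
  rewrite <- Rinv_1. apply Rinv_le_contravar; [lra|]. apply (le_INR 1). lia.
Qed.

Lemma walk_term_abs_le x k m : Rabs (walk_term x k m) <= / INR (S m) * walk (S m) k.
Proof.
  unfold walk_term. pose proof (inv_INR_S m). pose proof (walk_bounds (S m) k).
  assert (0 <= / INR (S m) * walk (S m) k) by nra.
  rewrite Rabs_mult, (Rabs_pos_eq (_ * _)) by easy.
  assert (Rabs (cos (INR k * x (S m))) <= 1) by apply Rabs_le, COS_bound. nra.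
Qed.

Lemma ex_series_walk_term x k r : 0 < r < 1 -> ex_series (fun m => r ^ S m * walk_term x k m).
Proof.
  intros Hr.
  apply (ex_series_le (K := R_AbsRing) (V := R_CompleteNormedModule)) with (fun m => r ^ m);
    [|apply ex_series_geom; rewrite Rabs_pos_eq; lra].
  intros m. change (Rabs (r ^ S m * walk_term x k m) <= r ^ m).
  pose proof (walk_term_abs_le x k m). pose proof (inv_INR_S m). pose proof (walk_bounds (S m) k).
  assert (0 < r ^ m) by (apply pow_lt; lra).
  rewrite <- tech_pow_Rmult, Rabs_mult, (Rabs_pos_eq (r * r ^ m)) by nra.
  pose proof (Rabs_pos (walk_term x k m)).
  assert (Rabs (walk_term x k m) <= 1) by nra. 
  apply Rle_trans with (r * r ^ m * 1); [apply Rmult_le_compat_l; nra|nra].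
Qed.

Definition power_term (x : nat -> R) (m : nat) : R :=
  / INR (S m) * ((2 + cos (x (S m))) / 3) ^ S m.

(** With only the harmonics up to K, the terms with n <= K are already exact, and the others
    carry r^n <= q^K q^n with q = sqrt r.  So truncation costs a multiple of q^K. *)
Lemma walk_exchange x r : 0 < r < 1 ->
  ex_series (fun m => r ^ S m * power_term x m) /\
  is_series (fun k => 2 * Series (fun m => r ^ S m * walk_term x (S k) m))
    (Series (fun m => r ^ S m * power_term x m) - Series (fun m => r ^ S m * walk_term x 0 m)).
Proof.
  intros Hr.
  assert (Hg : ex_series (fun m => r ^ S m * power_term x m)).
  { apply (ex_series_le (K := R_AbsRing) (V := R_CompleteNormedModule)) with (fun m => r ^ m);
      [|apply ex_series_geom; rewrite Rabs_pos_eq; lra].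
    intros m. change (Rabs (r ^ S m * power_term x m) <= r ^ m).
    unfold power_term. pose proof (inv_INR_S m) as Hi. pose proof (COS_bound (x (S m))) as Hc.
    assert (0 <= ((2 + cos (x (S m))) / 3) ^ S m <= 1).
    { split; [apply pow_le; lra|]. rewrite <- (pow1 (S m)). apply pow_incr. lra. }
    assert (0 < r ^ m) by (apply pow_lt; lra).
    rewrite <- tech_pow_Rmult.
    assert (0 <= / INR (S m) * ((2 + cos (x (S m))) / 3) ^ S m <= 1) by (split; nra).
    rewrite Rabs_pos_eq by (apply Rmult_le_pos; nra).
    apply Rle_trans with (r * r ^ m * 1); [apply Rmult_le_compat_l; nra|nra]. }
  split; [easy|].
  set (h := fun K m => r ^ S m * (/ INR (S m) * cos_poly (S m) K (x (S m)))).
  set (T := fun k => Series (fun m => r ^ S m * walk_term x k m)).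
  assert (Hh : forall K, is_series (h K) (T 0%nat + psum (fun k => 2 * T (S k)) K)).
  { induction K as [|K IH].
    - rewrite Rplus_0_r. eapply is_series_Rext; [|apply Series_correct, (ex_series_walk_term x 0 r Hr)].
      intros m. unfold h, cos_poly, walk_term. simpl psum. simpl (INR 0). rewrite Rmult_0_l, cos_0. ring.
    - rewrite psum_S, <- Rplus_assoc.
      pose proof (is_series_Rplus _ _ _ _ IH
        (is_series_Rscal 2 _ _ (Series_correct _ (ex_series_walk_term x (S K) r Hr)))) as Hsum.
      revert Hsum. apply is_series_Rext.
      intros m. unfold h, cos_poly, walk_term. rewrite psum_S. ring. }
  set (q := sqrt r).
  assert (Hq0 : 0 <= q) by apply sqrt_pos.
  assert (Hqq : q * q = r) by (apply sqrt_sqrt; lra).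
  assert (Hq : 0 < q < 1) by (split; nra).
  apply is_series_geom_error with (2 * / (1 - q)) q; [lra|]. intros K.
  fold (T 0%nat). change (psum _ K) with (psum (fun k => 2 * T (S k)) K).
  replace (Series (fun m => r ^ S m * power_term x m) - T 0%nat - psum (fun k => 2 * T (S k)) K)
    with (Series (fun m => r ^ S m * power_term x m) - (T 0%nat + psum (fun k => 2 * T (S k)) K)) by ring.
  assert (Hgeo : is_series (fun m => 2 * q ^ K * q ^ m) (2 * / (1 - q) * q ^ K)).
  { replace (2 * / (1 - q) * q ^ K) with (2 * q ^ K * / (1 - q)) by ring.
    apply is_series_Rscal, is_series_geom. rewrite Rabs_pos_eq; lra. }
  refine (is_series_Rabs_le _ _ _ _ _ (is_series_Rminus _ _ _ _ (Series_correct _ Hg) (Hh K)) Hgeo).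
  intros m. unfold h, power_term.
  assert (HqK : 0 < q ^ K) by (apply pow_lt; lra). assert (Hqm : 0 < q ^ m) by (apply pow_lt; lra).
  destruct (Nat.le_gt_cases (S m) K) as [HmK|HmK].
  - rewrite cos_poly_eq by easy. rewrite Rminus_diag, Rabs_R0. nra.
  - set (p := ((2 + cos (x (S m))) / 3) ^ S m). set (cp := cos_poly (S m) K (x (S m))).
    replace (r ^ S m * (/ INR (S m) * p) - r ^ S m * (/ INR (S m) * cp))
      with (r ^ S m * (/ INR (S m) * (p - cp))) by ring.
    assert (Hp : 0 <= p <= 1).
    { pose proof (COS_bound (x (S m))). unfold p.
      split; [apply pow_le; lra|]. rewrite <- (pow1 (S m)). apply pow_incr. lra. }
    pose proof (cos_poly_abs_le (S m) K (x (S m))) as Hcp. fold cp in Hcp.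
    assert (Hd : Rabs (p - cp) <= 2 * INR (S m)).
    { unfold Rminus. eapply Rle_trans; [apply Rabs_triang|].
      rewrite Rabs_Ropp, (Rabs_pos_eq p) by lra.
      assert (INR K + 1 <= INR (S m)) by (rewrite <- S_INR; apply le_INR; lia). lra. }
    assert (Hd' : Rabs (/ INR (S m) * (p - cp)) <= 2).
    { pose proof (inv_INR_S m). rewrite Rabs_mult, (Rabs_pos_eq (/ _)) by lra.
      apply Rle_trans with (/ INR (S m) * (2 * INR (S m))); [apply Rmult_le_compat_l; lra|].
      right. field. apply not_0_INR. lia. }
    assert (Hrm : 0 <= r ^ S m <= q ^ K * q ^ m).
    { split; [apply pow_le; lra|]. rewrite <- Hqq, Rpow_mult_distr.
      assert (forall a b, (a <= b)%nat -> q ^ b <= q ^ a) as Hdec.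
      { intros a b Hab. replace b with (a + (b - a))%nat by lia. rewrite pow_add.
        assert (0 < q ^ a) by (apply pow_lt; lra).
        assert (0 <= q ^ (b - a) <= 1); [|nra].
        split; [apply pow_le; lra|]. rewrite <- (pow1 (b - a)). apply pow_incr. lra. }
      apply Rmult_le_compat; try (apply pow_le; lra); apply Hdec; lia. }
    rewrite Rabs_mult, (Rabs_pos_eq (r ^ S m)) by lra.
    replace (2 * q ^ K * q ^ m) with (q ^ K * q ^ m * 2) by ring.
    apply Rmult_le_compat; try easy. apply Rabs_pos.
Qed.

Lemma walk_term_first_passage x k r l :
  is_series (fun n => first_passage n (S k) * r ^ n * cos (INR (S k) * x n)) l ->
  is_series (fun m => r ^ S m * walk_term x (S k) m) (l / INR (S k)).
Proof.
  intros H. apply is_series_tail in H.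
  assert (E0 : first_passage 0 (S k) = 0) by easy. rewrite E0, !Rmult_0_l, Rminus_0_r in H.
  apply (is_series_Rscal (/ INR (S k))) in H.
  unfold Rdiv. rewrite Rmult_comm. revert H. apply is_series_Rext. intros m.
  unfold walk_term. change (first_passage (S m) (S k)) with (INR (S k) / INR (S m) * walk (S m) (S k)).
  field. split; apply not_0_INR; lia.
Qed.

Lemma walk_mass k m : walk_term (fun _ => 0) k m = / INR (S m) * walk (S m) k.
Proof. unfold walk_term. rewrite Rmult_0_r, cos_0. ring. Qed.

Lemma walk_mass_nonneg k m : 0 <= / INR (S m) * walk (S m) k.
Proof. pose proof (inv_INR_S m). pose proof (walk_bounds (S m) k). nra. Qed.

(** Taking all angles equal to 0 in [walk_exchange] makes both sides logarithms:
    - log(1 - r) on the left, - 2 log(1 - v) for the harmonics k >= 1.  What is left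
    for k = 0 is log((1 - v)^2/(1 - r)) = log(6 v/r). *)
Lemma return_gen_eq r : 0 < r < 1 ->
  exists v, 0 < v < 1 /\ (1 - v) ^ 2 = 6 * v * (1 - r) / r /\
    exp (Series (fun m => r ^ S m * (/ INR (S m) * walk (S m) 0))) * r = 6 * v /\
    forall k, is_series (fun m => r ^ S m * (/ INR (S m) * walk (S m) (S k))) (v ^ S k / INR (S k)).
Proof.
  intros Hr. destruct (passage_gen_real r Hr) as (v & Hv & Ev & HF).
  exists v. split; [easy|]. split; [easy|].
  assert (HT : forall k, is_series (fun m => r ^ S m * walk_term (fun _ => 0) (S k) m) (v ^ S k / INR (S k))).
  { intros k. apply walk_term_first_passage. eapply is_series_Rext; [|apply (HF (S k))].
    intros n. cbv beta. rewrite Rmult_0_r, cos_0. ring. }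
  split.
  2: { intros k. eapply is_series_Rext; [|apply (HT k)]. intros m. cbv beta. now rewrite walk_mass. }
  destruct (walk_exchange (fun _ => 0) r Hr) as [_ H].
  assert (Hlog : is_series (fun k => 2 * Series (fun m => r ^ S m * walk_term (fun _ => 0) (S k) m)) (2 * - ln (1 - v))).
  { eapply is_series_Rext; [|apply (is_series_Rscal 2), (is_series_ln v); lra].
    intros k. cbv beta. now rewrite (is_series_unique _ _ (HT k)). }
  assert (Hpow : Series (fun m => r ^ S m * power_term (fun _ => 0) m) = - ln (1 - r)).
  { apply is_series_unique. eapply is_series_Rext; [|apply (is_series_ln r); lra].
    intros m. unfold power_term. rewrite cos_0. replace ((2 + 1) / 3) with 1 by lra.
    rewrite pow1. unfold Rdiv. ring. }
  rewrite Hpow in H.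
  pose proof (is_series_unique _ _ H) as E1. rewrite (is_series_unique _ _ Hlog) in E1.
  rewrite (Series_ext _ (fun m => r ^ S m * walk_term (fun _ => 0) 0 m))
    by (intros m; cbv beta; now rewrite walk_mass).
  replace (Series (fun m => r ^ S m * walk_term (fun _ => 0) 0 m))
    with (ln (1 - v) + ln (1 - v) + - ln (1 - r)) by lra.
  rewrite !exp_plus, exp_Ropp, !exp_ln by lra.
  replace ((1 - v) * (1 - v)) with ((1 - v) ^ 2) by ring. rewrite Ev. field. lra.
Qed.

(** Abel means of the first-passage laws are at most powers of v < 1; those of the return
    probabilities are log(6 v/r) <= log 12, as r >= 1/2. *)
Lemma ex_series_walk_mass k : ex_series (fun m => / INR (S m) * walk (S m) k).
Proof.
  apply (ex_series_abel _ (match k with O => ln 12 | S _ => 1 end)); [apply walk_mass_nonneg|].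
  intros i. pose proof (abel_radius_bounds i) as Hr.
  destruct (return_gen_eq (abel_radius i) ltac:(lra)) as (v & Hv & Ev & E0 & HS).
  destruct k as [|k].
  - assert (Hex : ex_series (fun m => abel_radius i ^ S m * (/ INR (S m) * walk (S m) 0))).
    { eapply ex_series_ext; [|apply (ex_series_walk_term (fun _ => 0) 0 (abel_radius i)); lra].
      intros m. cbv beta. now rewrite walk_mass. }
    eexists. split; [apply Series_correct, Hex|].
    set (L := Series _) in *. rewrite <- (ln_exp L).
    pose proof (exp_pos L) as HL.
    assert (HL12 : exp L <= 12) by nra.
    destruct HL12 as [Hlt|Heq]; [left; now apply ln_increasing|right; now rewrite Heq].
  - eexists. split; [apply HS|].
    assert (v ^ S k <= 1) by (rewrite <- (pow1 (S k)); apply pow_incr; lra).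
    assert (0 <= v ^ S k) by (apply pow_le; lra).
    pose proof (inv_INR_S k). unfold Rdiv. nra.
Qed.

(** In the limit r = 1 the equation for v becomes (1 - v)^2 = 0. *)
Lemma Series_return : Series (fun m => / INR (S m) * walk (S m) 0) = ln 6.
Proof.
  set (a := fun m => / INR (S m) * walk (S m) 0). set (L := Series a).
  assert (Hlim : is_lim_seq (fun i => Series (fun n => abel_radius i ^ S n * a n)) L).
  { apply abel_lim. eapply ex_series_ext; [|apply (ex_series_walk_mass 0)].
    intros m. cbv beta. symmetry. apply Rabs_pos_eq, walk_mass_nonneg. }
  set (v := fun i => exp (Series (fun n => abel_radius i ^ S n * a n)) * abel_radius i / 6).
  assert (Hv : is_lim_seq v (exp L * 1 / 6)).
  { unfold v, Rdiv. apply is_lim_seq_mult'; [|apply is_lim_seq_const].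
    apply is_lim_seq_mult'; [|apply abel_radius_lim].
    apply is_lim_seq_continuous; [|exact Hlim].
    apply derivable_continuous_pt, derivable_pt_exp. }
  assert (Ev : forall i, (1 - v i) * (1 - v i) * abel_radius i = 6 * v i * (1 - abel_radius i)).
  { intros i. pose proof (abel_radius_bounds i) as Hr.
    destruct (return_gen_eq (abel_radius i) ltac:(lra)) as (w & Hw & Ew & E0 & _).
    fold a in E0. replace (v i) with w by (unfold v, a; rewrite E0; field).
    replace ((1 - w) * (1 - w)) with ((1 - w) ^ 2) by ring. rewrite Ew. field. lra. }
  set (V := exp L * 1 / 6) in *.
  assert (H1 : is_lim_seq (fun i => (1 - v i) * (1 - v i) * abel_radius i) ((1 - V) * (1 - V) * 1)).
  { apply is_lim_seq_mult'; [|apply abel_radius_lim].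
    apply is_lim_seq_mult'; (apply is_lim_seq_minus'; [apply is_lim_seq_const|easy]). }
  assert (H2 : is_lim_seq (fun i => (1 - v i) * (1 - v i) * abel_radius i) (6 * V * (1 - 1))).
  { eapply is_lim_seq_ext; [intros i; symmetry; apply Ev|].
    apply is_lim_seq_mult'; [|apply is_lim_seq_minus'; [apply is_lim_seq_const|apply abel_radius_lim]].
    apply is_lim_seq_mult'; [apply is_lim_seq_const|easy]. }
  apply is_lim_seq_unique in H1. apply is_lim_seq_unique in H2. rewrite H1 in H2.
  injection H2 as H2. assert (HV : V = 1) by nra.
  rewrite <- (ln_exp L). f_equal. unfold V in HV. lra.
Qed.

(** * The limit at radius 1 *)

(** The sine of n is the cosine of this angle. *)
Definition bbg_angle (n : nat) : R := INR n - PI / 2.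

(** The sum is the real part of the generating function of first passage at
    z = r e^{ik}, up to a factor of modulus 1/k. *)
Lemma bbg_walk_bound k r : 0 < r < 1 ->
  Rabs (Series (fun m => r ^ S m * walk_term bbg_angle (S k) m)) <= passage_bound (S k).
Proof.
  intros Hr. set (t := INR (S k)). set (z := (RtoC r * expi t)%C).
  assert (Hm : Cmod z < 1).
  { unfold z. rewrite Cmod_mult, Cmod_R, expi_mod, Rabs_pos_eq; lra. }
  set (w := expi (- (t * (PI / 2)))).
  pose proof (is_Cseries_Cscal w _ _ (passage_gen_correct (S k) z Hm)) as H.
  apply is_Cseries_Re in H.
  set (F := CSeries (passage_term (S k) z)) in *.
  assert (HT : is_series (fun m => r ^ S m * walk_term bbg_angle (S k) m) (Re (w * F)%C / t)).
  { apply walk_term_first_passage. revert H. apply is_series_Rext. intros n. unfold passage_term, z.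
    rewrite Cpow_mult_l, expi_pow, <- RtoC_pow.
    replace (w * (RtoC (first_passage n (S k)) * (RtoC (r ^ n) * expi (INR n * t))))%C
      with (RtoC (first_passage n (S k) * r ^ n) * expi (t * bbg_angle n))%C.
    - apply Re_RtoC_expi.
    - replace (t * bbg_angle n) with (- (t * (PI / 2)) + INR n * t) by (unfold bbg_angle; ring).
      rewrite expi_plus, RtoC_mult. fold w. ring. }
  rewrite (is_series_unique _ _ HT).
  unfold Rdiv, passage_bound. fold t.
  assert (Ht : 0 < / t) by apply inv_INR_S.
  rewrite Rabs_mult, (Rabs_pos_eq (/ t)), Rmult_comm by lra.
  apply Rmult_le_compat_l; [lra|].
  eapply Rle_trans; [apply re_le_Cmod|].
  unfold w. rewrite Cmod_mult, expi_mod, Rmult_1_l.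
  exact (passage_gen_bound (S k) r t Hr).
Qed.

Lemma ex_series_abs_le (a b : nat -> R) : (forall n, Rabs (a n) <= b n) -> ex_series b ->
  ex_series (fun n => Rabs (a n)).
Proof.
  intros H. apply (ex_series_le (K := R_AbsRing) (V := R_CompleteNormedModule) (fun n => Rabs (a n)) b).
  intros n. change (Rabs (Rabs (a n)) <= b n). rewrite Rabs_Rabsolu. apply H.
Qed.

Lemma bbg_walk_lim k :
  is_lim_seq (fun i => Series (fun m => abel_radius i ^ S m * walk_term bbg_angle k m))
    (Series (walk_term bbg_angle k)).
Proof.
  apply abel_lim. apply ex_series_abs_le with (2 := ex_series_walk_mass k). apply walk_term_abs_le.
Qed.

Lemma bbg_walk_bound_1 k : Rabs (Series (walk_term bbg_angle (S k))) <= passage_bound (S k).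
Proof.
  apply is_lim_seq_Rabs_le with (2 := bbg_walk_lim (S k)).
  intros i. apply bbg_walk_bound. pose proof (abel_radius_bounds i). lra.
Qed.

Lemma S_BBG_term_power m : S_BBG_term m = power_term bbg_angle m.
Proof.
  unfold S_BBG_term, power_term, bbg_angle. do 4 f_equal.
  rewrite <- (cos_shift (INR (S m))). rewrite <- cos_neg. f_equal. ring.
Qed.

Lemma power_term_nonneg x m : 0 <= power_term x m.
Proof.
  unfold power_term. pose proof (inv_INR_S m). pose proof (COS_bound (x (S m))).
  apply Rmult_le_pos; [lra|apply pow_le; lra].
Qed.

Lemma ex_series_2_passage_bound : ex_series (fun k => 2 * passage_bound (S k)).
Proof. apply (ex_series_scal (K := R_AbsRing) (V := R_NormedModule)), ex_series_passage_bound. Qed.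

Lemma two_abs_le (y M : R) : Rabs y <= M -> Rabs (2 * y) <= 2 * M.
Proof. intros H. rewrite Rabs_mult, (Rabs_pos_eq 2); lra. Qed.

(** The Abel means are bounded thanks to [walk_exchange], the majorant and the
    summability of the return probabilities. *)
Lemma ex_series_bbg : ex_series (power_term bbg_angle).
Proof.
  set (m0 := fun m => / INR (S m) * walk (S m) 0).
  apply (ex_series_abel _ (Series m0 + Series (fun k => 2 * passage_bound (S k)))); [apply power_term_nonneg|].
  intros i. pose proof (abel_radius_bounds i) as Hr.
  destruct (walk_exchange bbg_angle (abel_radius i) ltac:(lra)) as [Hex HS].
  eexists. split; [apply Series_correct, Hex|].
  pose proof (is_series_Rabs_le _ _ _ _ (fun k => two_abs_le _ _ (bbg_walk_bound k (abel_radius i) ltac:(lra)))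
    HS (Series_correct _ ex_series_2_passage_bound)) as H.
  assert (H0 : Rabs (Series (fun m => abel_radius i ^ S m * walk_term bbg_angle 0 m)) <= Series m0).
  { apply (is_series_Rabs_le (fun m => abel_radius i ^ S m * walk_term bbg_angle 0 m) m0).
    - intros m. rewrite Rabs_mult. pose proof (abel_radius_pow_bounds i (S m)).
      rewrite (Rabs_pos_eq (abel_radius i ^ S m)) by lra.
      pose proof (walk_term_abs_le bbg_angle 0 m). unfold m0.
      pose proof (Rabs_pos (walk_term bbg_angle 0 m)). nra.
    - apply Series_correct, ex_series_walk_term. lra.
    - apply Series_correct, ex_series_walk_mass. }
  apply Rabs_le_between in H. apply Rabs_le_between in H0. lra.
Qed.

Lemma bbg_expansion :
  Series (power_term bbg_angle) = ln 6 + Series (fun k => 2 * Series (walk_term bbg_angle (S k))).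
Proof.
  assert (HL : is_lim_seq (fun i => Series (fun m => abel_radius i ^ S m * power_term bbg_angle m))
    (Series (power_term bbg_angle))).
  { apply abel_lim. eapply ex_series_ext; [|apply ex_series_bbg].
    intros m. cbv beta. symmetry. apply Rabs_pos_eq, power_term_nonneg. }
  assert (HR : is_lim_seq (fun i =>
      Series (fun m => abel_radius i ^ S m * walk_term bbg_angle 0 m) +
      Series (fun k => 2 * Series (fun m => abel_radius i ^ S m * walk_term bbg_angle (S k) m)))
    (Series (walk_term bbg_angle 0) + Series (fun k => 2 * Series (walk_term bbg_angle (S k))))).
  { apply is_lim_seq_plus'; [apply bbg_walk_lim|].
    apply (tannery (fun i k => 2 * Series (fun m => abel_radius i ^ S m * walk_term bbg_angle (S k) m))
      (fun k => 2 * Series (walk_term bbg_angle (S k))) (fun k => 2 * passage_bound (S k))).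
    - intros i k. apply two_abs_le, bbg_walk_bound. pose proof (abel_radius_bounds i). lra.
    - apply ex_series_2_passage_bound.
    - intros k. apply is_lim_seq_mult'; [apply is_lim_seq_const|apply bbg_walk_lim]. }
  assert (E0 : Series (walk_term bbg_angle 0) = ln 6).
  { rewrite <- Series_return. apply Series_ext. intros m.
    unfold walk_term. simpl (INR 0). rewrite Rmult_0_l, cos_0. ring. }
  rewrite <- E0.
  eapply is_lim_seq_ext in HR.
  - apply is_lim_seq_unique in HR. apply is_lim_seq_unique in HL. rewrite HR in HL. injection HL as HL.
    symmetry. exact HL.
  - intros i. pose proof (abel_radius_bounds i).
    destruct (walk_exchange bbg_angle (abel_radius i) ltac:(lra)) as [_ HS].
    rewrite (is_series_unique _ _ HS). ring.
Qed.

(** * The Fourier coefficients and the theorem *)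

Lemma is_RInt_Rext (f g : R -> R) a b (l : R) :
  (forall x, f x = g x) -> is_RInt f a b l -> is_RInt g a b l.
Proof. intros H. apply is_RInt_ext. intros x _. apply H. Qed.

Lemma is_RInt_Rval (f : R -> R) a b (l l' : R) :
  l = l' -> is_RInt f a b l -> is_RInt f a b l'.
Proof. now intros ->. Qed.

Lemma is_RInt_Rscal (f : R -> R) a b (k l : R) :
  is_RInt f a b l -> is_RInt (fun x => k * f x) a b (k * l).
Proof. exact (is_RInt_scal f a b k l). Qed.

Lemma is_RInt_Rplus (f g : R -> R) a b (l m : R) :
  is_RInt f a b l -> is_RInt g a b m -> is_RInt (fun x => f x + g x) a b (l + m).
Proof. exact (is_RInt_plus f g a b l m). Qed.

Lemma is_RInt_cos_period N phi : (1 <= N)%nat ->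
  is_RInt (fun t => cos (INR N * t + phi)) 0 (2 * PI) 0.
Proof.
  intros HN. assert (HN0 : INR N <> 0) by (apply not_0_INR; lia).
  assert (H : is_RInt (fun t => cos (INR N * t + phi)) 0 (2 * PI)
    (minus (sin (INR N * (2 * PI) + phi) / INR N) (sin (INR N * 0 + phi) / INR N))).
  { apply (is_RInt_derive (V := R_CompleteNormedModule)
      (fun t => sin (INR N * t + phi) / INR N) (fun t => cos (INR N * t + phi))).
    - intros t _. auto_derive; [easy|]. field. easy.
    - intros t _. apply (ex_derive_continuous (fun t => cos (INR N * t + phi))).
      auto_derive. easy. }
  replace (INR N * (2 * PI) + phi) with (phi + 2 * INR N * PI) in H by ring.
  rewrite sin_period, Rmult_0_r, Rplus_0_l in H.
  replace 0 with (minus (sin phi / INR N) (sin phi / INR N)) at 2 by apply Rminus_diag.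
  exact H.
Qed.

Lemma is_RInt_cos_diff k j phi : is_RInt (fun t => cos ((INR k - INR j) * t + phi)) 0 (2 * PI)
  (if Nat.eqb k j then 2 * PI * cos phi else 0).
Proof.
  destruct (Nat.lt_trichotomy k j) as [H|[H|H]].
  - rewrite (proj2 (Nat.eqb_neq k j)) by lia.
    apply is_RInt_Rext with (2 := is_RInt_cos_period (j - k) (- phi) ltac:(lia)).
    intros t. rewrite minus_INR by lia. rewrite <- cos_neg. f_equal. ring.
  - subst j. rewrite Nat.eqb_refl.
    apply is_RInt_Rext with (fun _ => cos phi).
    + intros t. f_equal. ring.
    + pose proof (is_RInt_const (V := R_NormedModule) 0 (2 * PI) (cos phi)) as Hc.
      replace (2 * PI * cos phi) with (scal (2 * PI - 0) (cos phi)); [exact Hc|].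
      rewrite Rminus_0_r. easy.
  - rewrite (proj2 (Nat.eqb_neq k j)) by lia.
    apply is_RInt_Rext with (2 := is_RInt_cos_period (k - j) phi ltac:(lia)).
    intros t. now rewrite minus_INR by lia.
Qed.

Lemma is_RInt_cos_cos k j psi : (1 <= k)%nat ->
  is_RInt (fun t => cos (INR k * t + psi) * cos (INR j * (t - PI / 2))) 0 (2 * PI)
    (if Nat.eqb k j then PI * cos (INR k * (PI / 2) + psi) else 0).
Proof.
  intros Hk.
  pose proof (is_RInt_Rplus _ _ _ _ _ _
    (is_RInt_cos_period (k + j) (psi - INR j * (PI / 2)) ltac:(lia))
    (is_RInt_cos_diff k j (psi + INR j * (PI / 2)))) as H.
  apply (is_RInt_Rscal _ _ _ (/ 2)) in H.
  refine (is_RInt_Rval _ _ _ _ _ _ (is_RInt_Rext _ _ _ _ _ _ H)).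
  2: { intros t. rewrite plus_INR.
    replace ((INR k + INR j) * t + (psi - INR j * (PI / 2)))
      with (INR k * t + psi + INR j * (t - PI / 2)) by ring.
    replace ((INR k - INR j) * t + (psi + INR j * (PI / 2)))
      with (INR k * t + psi - INR j * (t - PI / 2)) by ring.
    rewrite cos_plus, cos_minus. field. }
  destruct (Nat.eqb_spec k j) as [->|_]; [|ring].
  rewrite (Rplus_comm psi). field.
Qed.

(** The phase psi serves to treat the real part (psi = 0) and the imaginary part
    (psi = pi/2) of the Fourier coefficient at once. *)
Lemma is_RInt_cos_poly k n K psi : (1 <= k)%nat ->
  is_RInt (fun t => cos (INR k * t + psi) * cos_poly n K (t - PI / 2)) 0 (2 * PI)
    (if Nat.leb k K then 2 * PI * walk n k * cos (INR k * (PI / 2) + psi) else 0).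
Proof.
  intros Hk. induction K as [|K IH].
  - rewrite (proj2 (Nat.leb_gt k 0)) by lia.
    pose proof (is_RInt_Rscal _ _ _ (walk n 0) _ (is_RInt_cos_period k psi Hk)) as H.
    rewrite Rmult_0_r in H. revert H. apply is_RInt_Rext. intros t.
    unfold cos_poly. simpl psum. ring.
  - pose proof (is_RInt_Rplus _ _ _ _ _ _ IH
      (is_RInt_Rscal _ _ _ (2 * walk n (S K)) _ (is_RInt_cos_cos k (S K) psi Hk))) as H.
    refine (is_RInt_Rval _ _ _ _ _ _ (is_RInt_Rext _ _ _ _ _ _ H));
      [|intros t; unfold cos_poly; rewrite psum_S; ring].
    destruct (Nat.leb_spec k K), (Nat.leb_spec k (S K)), (Nat.eqb_spec k (S K)); try lia; try ring.
    subst k. ring.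
Qed.

Lemma is_RInt_sin_power k n psi : (1 <= k)%nat ->
  is_RInt (fun t => (1 + sin t / 2) ^ n * cos (INR k * t + psi)) 0 (2 * PI)
    (2 * PI * ((3 / 2) ^ n * walk n k * cos (INR k * (PI / 2) + psi))).
Proof.
  intros Hk.
  pose proof (is_RInt_Rscal _ _ _ ((3 / 2) ^ n) _ (is_RInt_cos_poly k n (Nat.max n k) psi Hk)) as H.
  rewrite (proj2 (Nat.leb_le k (Nat.max n k))) in H by lia.
  replace (2 * PI * ((3 / 2) ^ n * walk n k * cos (INR k * (PI / 2) + psi)))
    with ((3 / 2) ^ n * (2 * PI * walk n k * cos (INR k * (PI / 2) + psi))) by ring.
  revert H. apply is_RInt_Rext. intros t.
  rewrite cos_poly_eq by lia.
  rewrite (Rmult_comm (cos _)), <- Rmult_assoc, <- Rpow_mult_distr. f_equal. f_equal.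
  replace (cos (t - PI / 2)) with (sin t); [field|].
  rewrite <- cos_shift, <- cos_neg. f_equal. ring.
Qed.

(** The shift by pi/2 between sine and cosine is the factor (-i)^k. *)
Lemma c_eq k n : (1 <= k)%nat ->
  c k n = (RtoC ((3 / 2) ^ n * walk n k) * expi (- (INR k * (PI / 2))))%C.
Proof.
  intros Hk. pose proof PI_RGT_0 as Hpi. unfold c.
  set (A := 2 * PI * ((3 / 2) ^ n * walk n k * cos (INR k * (PI / 2)))).
  set (B := 2 * PI * ((3 / 2) ^ n * walk n k * - sin (INR k * (PI / 2)))).
  replace (RInt (V := C_R_CompleteNormedModule) _ 0 (2 * PI)) with ((A, B) : C).
  - unfold expi, RtoC, Cmult, A, B. simpl. rewrite cos_neg, sin_neg. f_equal; field; lra.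
  - symmetry. apply (is_RInt_unique (V := C_R_CompleteNormedModule)).
    apply (is_RInt_fct_extend_pair (U := R_NormedModule) (V := R_NormedModule)).
    + pose proof (is_RInt_sin_power k n 0 Hk) as H. rewrite Rplus_0_r in H.
      revert H. apply is_RInt_Rext. intros t. unfold expi, RtoC, Cmult. simpl.
      rewrite cos_neg, Rplus_0_r. ring.
    + pose proof (is_RInt_sin_power k n (PI / 2) Hk) as H.
      rewrite cos_plus, cos_PI2, sin_PI2 in H.
      replace (cos (INR k * (PI / 2)) * 0 - sin (INR k * (PI / 2)) * 1)
        with (- sin (INR k * (PI / 2))) in H by ring.
      revert H. apply is_RInt_Rext. intros t. unfold expi, RtoC, Cmult. simpl.
      rewrite sin_neg, cos_plus, cos_PI2, sin_PI2. ring.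
Qed.

Lemma G_term_eq k m : (1 <= k)%nat ->
  G_term k (G_point k) m =
  (RtoC (/ INR (S m) * walk (S m) k) * expi (INR k * bbg_angle (S m)))%C.
Proof.
  intros Hk. unfold G_term, G_point. rewrite c_eq by easy.
  rewrite Cpow_mult_l, expi_pow, <- RtoC_pow.
  assert (Hm : INR (S m) <> 0) by (apply not_0_INR; lia).
  replace (INR k * bbg_angle (S m)) with (- (INR k * (PI / 2)) + INR (S m) * INR k)
    by (unfold bbg_angle; ring).
  rewrite expi_plus.
  replace (/ INR (S m) * walk (S m) k)
    with ((3 / 2) ^ S m * walk (S m) k * / INR (S m) * (2 / 3) ^ S m).
  - rewrite (RtoC_mult (_ * / INR (S m))), (RtoC_mult _ (/ INR (S m))), RtoC_inv by easy.
    field. intros E. apply RtoC_inj in E. easy.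
  - replace ((3 / 2) ^ S m * walk (S m) k * / INR (S m) * (2 / 3) ^ S m)
      with (((3 / 2) ^ S m * (2 / 3) ^ S m) * (/ INR (S m) * walk (S m) k)) by ring.
    rewrite <- Rpow_mult_distr. replace (3 / 2 * (2 / 3)) with 1 by lra.
    rewrite pow1. ring.
Qed.

Lemma ex_Cseries_G_term k : (1 <= k)%nat -> ex_Cseries (G_term k (G_point k)).
Proof.
  intros Hk. apply ex_Cseries_le with (2 := ex_series_walk_mass k).
  intros m. rewrite G_term_eq, Cmod_mult, Cmod_R, expi_mod, Rmult_1_r by easy.
  right. apply Rabs_pos_eq, walk_mass_nonneg.
Qed.

Lemma rhs_term_eq j : rhs_term j = 2 * Series (walk_term bbg_angle (S j)).
Proof.
  unfold rhs_term, G. f_equal.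
  destruct (ex_Cseries_G_term (S j) ltac:(lia)) as [l Hl].
  rewrite (CSeries_unique _ _ Hl). symmetry. apply is_series_unique.
  apply is_Cseries_Re in Hl. revert Hl. apply is_series_Rext. intros m.
  rewrite G_term_eq by lia. apply Re_RtoC_expi.
Qed.

Theorem theorem3p5 :
  ex_series S_BBG_term /\
  (forall k : nat, (1 <= k)%nat ->
     ex_series (K := C_AbsRing) (V := C_NormedModule) (G_term k (G_point k))) /\
  ex_series (fun j : nat => Rabs (rhs_term j)) /\
  S_BBG = ln 6 + Series rhs_term.
Proof.
  split; [|split; [exact ex_Cseries_G_term|split]].
  - apply (ex_series_ext (power_term bbg_angle)); [|apply ex_series_bbg].
    intros m. symmetry. apply S_BBG_term_power.
  - apply ex_series_abs_le with (2 := ex_series_2_passage_bound).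
    intros j. rewrite rhs_term_eq. apply two_abs_le, bbg_walk_bound_1.
  - unfold S_BBG. rewrite (Series_ext _ _ S_BBG_term_power), (Series_ext _ _ rhs_term_eq).
    apply bbg_expansion.
Qed.
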